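(* Let $X$ be a uniformly convex and uniformly smooth Banach space, continuously embedded in a Banach space $Y$, and let $D\ni I$ be a subset of a dislocation group $D_0$ on $X$ whose elements also act as bijective linear isometries of $Y$. Then every bounded sequence $(u_k)\subset X$ admits a Δ-profile decomposition relative to $D$ (with the energy bound $\limsup\|r_k\|+\sum_n\delta(\|w^{(n)}\|)\le1$ when $\|u_k\|\le1$). Furthermore, if the embedding $X\hookrightarrow Y$ is $D,X$-cocompact, or if $X$ satisfies Opial's condition and $X\hookrightarrow Y$ is cocompact relative to $D$, then the remainder $(r_k)$ converges to $0$ in the norm of $Y$.
   Context: Δ-convergence: $x_k\rightharpoondown x$ if for every $y\in X$, $\limsup_k(\|x_k-x\|-\|x_k-y\|)\le0$. A group $D_0$ of bijective linear isometries of $X$ is a dislocation group if: $(\ast)$ whenever $(g_k)\subset D_0$ and $g_k\not\rightharpoonup0$ (pointwise weakly), some subsequence has both $(g_{k_j})$ and $(g_{k_j}^{-1})$ pointwise norm-convergent; and $(\ast\ast)$ whenever $u_k\rightharpoondown0$, $w\in X$, $(g_k)\subset D_0$, $g_k\rightharpoonup0$, then $u_k+g_kw\rightharpoondown0$. $(r_k)$ is $D$-Δ-convergent to $u$ if $g_k^{-1}(r_k-u)\rightharpoondown0$ for all $(g_k)\subset D$; $D$-weakly convergent to $0$ if $g_k^{-1}r_k\rightharpoonup0$ for all $(g_k)\subset D$. Δ-profile decomposition: $w^{(n)}\in X$, $(g_k^{(n)})\subset D$, $g_k^{(1)}=I$, $(g_k^{(n)})^{-1}g_k^{(m)}\rightharpoonup0$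 for $m\ne n$, and $(r_k)$ $D$-Δ-convergent to $0$ with, along a subsequence, $u_k=\sum_n g_k^{(n)}w^{(n)}+r_k$, the series converging unconditionally and uniformly in $k$. $\delta$ is the modulus of convexity of $X$. The embedding is $D,X$-cocompact if every sequence $D$-Δ-convergent in $X$ converges in the norm of $Y$ (to the same limit); it is cocompact relative to $D$ if every sequence in $X$ converging $D$-weakly to $0$ converges to $0$ in $Y$. Opial's condition: whenever $x_n\rightharpoonup x_0$, $\liminf\|x_n-x_0\|\le\liminf\|x_n-x\|$ for all $x$. *)

(* Defs.v *)
From Stdlib Require Import Reals Lra List ClassicalEpsilon.
Import ListNotations.
Open Scope R_scope.

Record NormedSpace := {
  V :> Type;
  vadd : V -> V -> V;
  vopp : V -> V;
  vzero : V;
  vscal : R -> V -> V;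
  vnorm : V -> R;
  vadd_assoc : forall x y z, vadd x (vadd y z) = vadd (vadd x y) z;
  vadd_comm : forall x y, vadd x y = vadd y x;
  vadd_0 : forall x, vadd vzero x = x;
  vadd_opp : forall x, vadd x (vopp x) = vzero;
  vscal_addv : forall a x y, vscal a (vadd x y) = vadd (vscal a x) (vscal a y);
  vscal_adds : forall a b x, vscal (a + b) x = vadd (vscal a x) (vscal b x);
  vscal_mul : forall a b x, vscal (a * b) x = vscal a (vscal b x);
  vscal_1 : forall x, vscal 1 x = x;
  vnorm_eq0 : forall x, vnorm x = 0 -> x = vzero;
  vnorm_scal : forall a x, vnorm (vscal a x) = Rabs a * vnorm x;
  vnorm_triangle : forall x y, vnorm (vadd x y) <= vnorm x + vnorm y
}.

Arguments vadd {n}. Arguments vopp {n}. Arguments vzero {n}.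
Arguments vscal {n}. Arguments vnorm {n}.

Definition vsub {X : NormedSpace} (x y : X) : X := vadd x (vopp y).

Definition norm_cv {X : NormedSpace} (x : nat -> X) (l : X) : Prop :=
  Un_cv (fun k => vnorm (vsub (x k) l)) 0.

Definition Cauchy_seq {X : NormedSpace} (x : nat -> X) : Prop :=
  forall eps, eps > 0 -> exists N, forall m n, (m >= N)%nat -> (n >= N)%nat ->
    vnorm (vsub (x m) (x n)) < eps.

Definition Banach (X : NormedSpace) : Prop :=
  forall x : nat -> X, Cauchy_seq x -> exists l, norm_cv x l.

Definition bounded_seq {X : NormedSpace} (x : nat -> X) : Prop :=
  exists C, forall k, vnorm (x k) <= C.

Definition is_linear {X Y : NormedSpace} (f : X -> Y) : Prop :=
  (forall x y, f (vadd x y) = vadd (f x) (f y)) /\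
  (forall a x, f (vscal a x) = vscal a (f x)).

Definition bounded_linear_functional {X : NormedSpace} (f : X -> R) : Prop :=
  (forall x y, f (vadd x y) = f x + f y) /\
  (forall a x, f (vscal a x) = a * f x) /\
  (exists C, forall x, Rabs (f x) <= C * vnorm x).

Definition weak_cv {X : NormedSpace} (x : nat -> X) (l : X) : Prop :=
  forall f : X -> R, bounded_linear_functional f -> Un_cv (fun k => f (x k)) (f l).

Definition ptw_weak0 {X : NormedSpace} (g : nat -> X -> X) : Prop :=
  forall x, weak_cv (fun k => g k x) vzero.

Definition limsup_le0 (a : nat -> R) : Prop :=
  forall eps, eps > 0 -> exists N, forall k, (k >= N)%nat -> a k <= eps.

Definition delta_cv {X : NormedSpace} (x : nat -> X) (l : X) : Prop :=
  forall y : X, limsup_le0 (fun k => vnorm (vsub (x k) l) - vnorm (vsub (x k) y)).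

Definition is_inverse {X : Type} (g h : X -> X) : Prop :=
  (forall x, g (h x) = x) /\ (forall x, h (g x) = x).

Definition bij_lin_isometry {X : NormedSpace} (g : X -> X) : Prop :=
  is_linear g /\ (exists h, is_inverse g h) /\ (forall x, vnorm (g x) = vnorm x).

Definition isometry_group {X : NormedSpace} (D0 : (X -> X) -> Prop) : Prop :=
  (forall g, D0 g -> bij_lin_isometry g) /\
  D0 (fun x => x) /\
  (forall g h, D0 g -> D0 h -> D0 (fun x => g (h x))) /\
  (forall g h, D0 g -> is_inverse g h -> D0 h).

Definition strictly_incr (phi : nat -> nat) : Prop :=
  forall n, (phi n < phi (S n))%nat.

Definition dislocation_group {X : NormedSpace} (D0 : (X -> X) -> Prop) : Prop :=
  isometry_group D0 /\
  (forall (g h : nat -> X -> X),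
     (forall k, D0 (g k)) -> (forall k, is_inverse (g k) (h k)) ->
     ~ ptw_weak0 g ->
     exists phi, strictly_incr phi /\
       (forall x, exists l, norm_cv (fun j => g (phi j) x) l) /\
       (forall x, exists l, norm_cv (fun j => h (phi j) x) l)) /\
  (forall (u : nat -> X) (w : X) (g : nat -> X -> X),
     delta_cv u vzero -> (forall k, D0 (g k)) -> ptw_weak0 g ->
     delta_cv (fun k => vadd (u k) (g k w)) vzero).

Definition D_delta_cv {X : NormedSpace} (D : (X -> X) -> Prop) (r : nat -> X) (u : X) : Prop :=
  forall (g h : nat -> X -> X), (forall k, D (g k)) -> (forall k, is_inverse (g k) (h k)) ->
    delta_cv (fun k => h k (vsub (r k) u)) vzero.

Definition D_weak0 {X : NormedSpace} (D : (X -> X) -> Prop) (r : nat -> X) : Prop :=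
  forall (g h : nat -> X -> X), (forall k, D (g k)) -> (forall k, is_inverse (g k) (h k)) ->
    weak_cv (fun k => h k (r k)) vzero.

Definition uniformly_convex (X : NormedSpace) : Prop :=
  forall eps, 0 < eps <= 2 -> exists d, d > 0 /\
    forall x y : X, vnorm x <= 1 -> vnorm y <= 1 -> vnorm (vsub x y) >= eps ->
      vnorm (vscal (1/2) (vadd x y)) <= 1 - d.

Definition uniformly_smooth (X : NormedSpace) : Prop :=
  forall eps, eps > 0 -> exists t0, t0 > 0 /\
    forall t, 0 < t < t0 -> forall x y : X, vnorm x = 1 -> vnorm y = 1 ->
      (vnorm (vadd x (vscal t y)) + vnorm (vsub x (vscal t y))) / 2 - 1 <= eps * t.

Definition is_glb (S : R -> Prop) (d : R) : Prop :=
  (forall s, S s -> d <= s) /\ (forall b, (forall s, S s -> b <= s) -> b <= d).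

Definition modconv_set (X : NormedSpace) (t : R) : R -> Prop :=
  fun s => exists x y : X, vnorm x <= 1 /\ vnorm y <= 1 /\ vnorm (vsub x y) >= t /\
    s = 1 - vnorm (vscal (1/2) (vadd x y)).

Definition modconv (X : NormedSpace) (t : R) : R :=
  epsilon (inhabits 0) (fun d => is_glb (modconv_set X t) d).

(** Opial's condition: liminf a <= liminf b expressed through strict lower bounds *)
Definition liminf_gt (a : nat -> R) (c : R) : Prop :=
  exists c', c' > c /\ exists N, forall n, (n >= N)%nat -> a n >= c'.

Definition liminf_le (a b : nat -> R) : Prop :=
  forall c, liminf_gt a c -> liminf_gt b c.

Definition Opial (X : NormedSpace) : Prop :=
  forall (x : nat -> X) (x0 : X), weak_cv x x0 ->
    forall y : X, liminf_le (fun n => vnorm (vsub (x n) x0)) (fun n => vnorm (vsub (x n) y)).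

Definition continuous_embedding {X Y : NormedSpace} (J : X -> Y) : Prop :=
  is_linear J /\ (forall x y, J x = J y -> x = y) /\
  (exists C, forall x, vnorm (J x) <= C * vnorm x).

Definition DX_cocompact {X Y : NormedSpace} (J : X -> Y) (D : (X -> X) -> Prop) : Prop :=
  forall (x : nat -> X) (u : X), D_delta_cv D x u -> norm_cv (fun k => J (x k)) (J u).

Definition cocompact_rel {X Y : NormedSpace} (J : X -> Y) (D : (X -> X) -> Prop) : Prop :=
  forall x : nat -> X, D_weak0 D x -> norm_cv (fun k => J (x k)) vzero.

Definition lsum {X : NormedSpace} (F : list nat) (a : nat -> X) : X :=
  fold_right (fun n acc => vadd (a n) acc) vzero F.

Definition lsumR (F : list nat) (a : nat -> R) : R :=
  fold_right (fun n acc => a n + acc) 0 F.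

(* Main.v *)
(* Profiles are extracted greedily: each new one is a Delta-limit of moved remainders along a
   subsequence, of norm at least half of what is possible.  A further nonzero profile forces its
   dislocations to be asymptotically orthogonal to the earlier ones by (star), and (star star) then keeps the
   remainder Delta-null along all earlier dislocations.  The norms of the remainders
   decrease to a limit, and by uniform convexity a midpoint argument makes all finite sums of late
   profiles asymptotically small, uniformly over the choice of the terms.  Replacing, block by block, the
   dislocations at small indices by ones at larger indices turns this into convergence uniform in k.
   Maximality of the choices and stability of Delta-limits show that the full remainder is
   D-Delta-null.  Under Opial's condition a bounded Delta-null sequence is weakly null, because bounded
   sequences have weakly convergent subsequences; the functionals needed for this are the derivatives of the norm. *)
Require Import Defs.
From Stdlib Require Import Reals List Lra Lia Classical ClassicalEpsilon Cantor FunctionalExtensionality.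
Import ListNotations.
Open Scope R_scope.

(** * Vector identities and subsequences *)

(** Delta-limits are not additive: the Delta-limit of a sum or difference of two sequences need not
    be the sum or difference of their limits. Profile terms are therefore added and removed one at a
    time through (star star), and close sequences are compared through midpoints and uniform
    convexity instead of by subtraction. A second obstacle is that each estimate on finitely many
    profiles holds only for k beyond a threshold depending on those profiles, whereas the series has
    to be controlled at every k at once. This is why the final remainder is the original sequence
    minus the sum of a modified series, and is compared with the remainders of the extraction only
    for late k. The first dislocation is prescribed to be the identity, so the first profile is not
    chosen for maximality and may be zero while still being counted. The factor one half in the
    later choices makes them possible even when the supremum of the available norms is not
    attained. *)

Inductive vexpr :=
  | EVar (n : nat) | EZero | EAdd (a b : vexpr) | EOpp (a : vexpr) | EScal (c : R) (a : vexpr).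

Fixpoint vden {X : NormedSpace} (env : list X) (e : vexpr) : X :=
  match e with
  | EVar n => nth n env vzero
  | EZero => vzero
  | EAdd a b => vadd (vden env a) (vden env b)
  | EOpp a => vopp (vden env a)
  | EScal c a => vscal c (vden env a)
  end.

Fixpoint vcoef (e : vexpr) (i : nat) : R :=
  match e with
  | EVar n => if Nat.eqb n i then 1 else 0
  | EZero => 0
  | EAdd a b => vcoef a i + vcoef b i
  | EOpp a => - vcoef a i
  | EScal c a => c * vcoef a i
  end.

Fixpoint lincomb {X : NormedSpace} (c : nat -> R) (env : list X) : X :=
  match env with
  | [] => vzero
  | x :: t => vadd (vscal (c 0%nat) x) (lincomb (fun i => c (S i)) t)
  end.

(** A finite conjunction instead of a quantified statement: after [cbn] it is one scalar equation
    per atom, within reach of [ring]. *)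
Fixpoint coef_eq (n : nat) (c d : nat -> R) : Prop :=
  match n with
  | O => True
  | S n => c 0%nat = d 0%nat /\ coef_eq n (fun i => c (S i)) (fun i => d (S i))
  end.

Section VectorIdentities.
Context {X : NormedSpace}.
Implicit Types x y z : X.

Lemma vadd_0_r x : vadd x vzero = x.
Proof. rewrite vadd_comm; apply vadd_0. Qed.

Lemma vadd_cancel x y z : vadd x y = vadd x z -> y = z.
Proof.
  assert (K : forall t, vadd (vopp x) (vadd x t) = t).
  { intros t. rewrite vadd_assoc, (vadd_comm X (vopp x)), vadd_opp. apply vadd_0. }
  intros H. now rewrite <- (K y), H, K.
Qed.

Lemma vscal_0l x : vscal 0 x = vzero.
Proof.
  apply (vadd_cancel (vscal 0 x)). rewrite <- vscal_adds, (vadd_0_r (vscal 0 x)). f_equal; ring.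
Qed.

Lemma vscal_0r a : vscal a (vzero : X) = vzero.
Proof.
  apply (vadd_cancel (vscal a vzero)). now rewrite <- vscal_addv, !vadd_0_r.
Qed.

Lemma vopp_scal x : vopp x = vscal (-1) x.
Proof.
  apply (vadd_cancel x). rewrite vadd_opp.
  transitivity (vadd (vscal 1 x) (vscal (-1) x)); [|now rewrite vscal_1].
  rewrite <- vscal_adds. replace (1 + -1) with 0 by ring. now rewrite vscal_0l.
Qed.

Lemma lincomb_zero (env : list X) c : (forall i, c i = 0) -> lincomb c env = vzero.
Proof.
  revert c. induction env as [|x t IH]; intros c H; simpl; [reflexivity|].
  rewrite H, vscal_0l, vadd_0. apply IH. intros i; apply H.
Qed.

Lemma lincomb_add (env : list X) c d :
  lincomb (fun i => c i + d i) env = vadd (lincomb c env) (lincomb d env).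
Proof.
  revert c d. induction env as [|x t IH]; intros c d; simpl; [now rewrite vadd_0|].
  rewrite (IH (fun i => c (S i)) (fun i => d (S i))), vscal_adds, !vadd_assoc.
  f_equal. rewrite <- !vadd_assoc. f_equal. apply vadd_comm.
Qed.

Lemma lincomb_scal (env : list X) a c :
  lincomb (fun i => a * c i) env = vscal a (lincomb c env).
Proof.
  revert c. induction env as [|x t IH]; intros c; simpl; [now rewrite vscal_0r|].
  rewrite (IH (fun i => c (S i))), vscal_addv, vscal_mul. reflexivity.
Qed.

Lemma lincomb_var (env : list X) n :
  lincomb (fun i => if Nat.eqb n i then 1 else 0) env = nth n env vzero.
Proof.
  revert n. induction env as [|x t IH]; intros n; simpl; [now destruct n|].
  destruct n; simpl.
  - rewrite vscal_1, (lincomb_zero t (fun _ => 0)) by reflexivity. apply vadd_0_r.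
  - rewrite vscal_0l, vadd_0. apply IH.
Qed.

Lemma vden_lincomb (env : list X) e : vden env e = lincomb (vcoef e) env.
Proof.
  induction e; simpl.
  - now rewrite lincomb_var.
  - now rewrite lincomb_zero.
  - rewrite lincomb_add. congruence.
  - rewrite vopp_scal, IHe, <- lincomb_scal. f_equal. apply functional_extensionality. intros; ring.
  - rewrite lincomb_scal. congruence.
Qed.

Lemma lincomb_ext (env : list X) c d : coef_eq (length env) c d -> lincomb c env = lincomb d env.
Proof.
  revert c d. induction env as [|x t IH]; intros c d H; simpl in *; [reflexivity|].
  destruct H as [H1 H2]. rewrite H1. f_equal. now apply IH.
Qed.

Lemma vden_eq (env : list X) e1 e2 :
  coef_eq (length env) (vcoef e1) (vcoef e2) -> vden env e1 = vden env e2.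
Proof. rewrite !vden_lincomb. apply lincomb_ext. Qed.

End VectorIdentities.

Ltac v_in x l :=
  match l with
  | nil => constr:(false)
  | cons x _ => constr:(true)
  | cons _ ?t => v_in x t
  end.
Ltac v_atoms e l :=
  match e with
  | vadd ?a ?b => let l1 := v_atoms a l in v_atoms b l1
  | vsub ?a ?b => let l1 := v_atoms a l in v_atoms b l1
  | vopp ?a => v_atoms a l
  | vscal _ ?a => v_atoms a l
  | vzero => l
  | _ => match v_in e l with true => l | false => constr:(cons e l) end
  end.
Ltac v_index x l :=
  match l with
  | cons x _ => constr:(O)
  | cons _ ?t => let n := v_index x t in constr:(S n)
  end.
Ltac v_reify e l :=
  match e with
  | vadd ?a ?b => let a' := v_reify a l in let b' := v_reify b l in constr:(EAdd a' b')
  | vsub ?a ?b => let a' := v_reify a l in let b' := v_reify b l in constr:(EAdd a' (EOpp b'))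
  | vopp ?a => let a' := v_reify a l in constr:(EOpp a')
  | vscal ?c ?a => let a' := v_reify a l in constr:(EScal c a')
  | vzero => constr:(EZero)
  | _ => let n := v_index e l in constr:(EVar n)
  end.
(* Proves an equality of linear combinations by comparing the coefficients of each atom. *)
Ltac vlin :=
  match goal with
  | |- @eq (V ?X) ?a ?b =>
      let l0 := v_atoms a (@nil (V X)) in
      let l := v_atoms b l0 in
      let ea := v_reify a l in
      let eb := v_reify b l in
      change (vden l ea = vden l eb); apply vden_eq;
      cbn [length coef_eq vcoef Nat.eqb]; repeat split; first [ring | lra | field; lra]
  end.

Section NormFacts.
Context {X : NormedSpace}.
Implicit Types x y z : X.

Lemma vnorm_zero : vnorm (vzero : X) = 0.
Proof. rewrite <- (vscal_0l vzero), vnorm_scal, Rabs_R0. ring. Qed.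

Lemma vnorm_opp x : vnorm (vopp x) = vnorm x.
Proof. rewrite vopp_scal, vnorm_scal, Rabs_left; lra. Qed.

Lemma vnorm_nonneg x : 0 <= vnorm x.
Proof.
  assert (H := vnorm_triangle X x (vopp x)).
  rewrite vadd_opp, vnorm_zero, vnorm_opp in H. lra.
Qed.

Lemma vnorm_sum x y z : x = vadd y z -> vnorm x <= vnorm y + vnorm z.
Proof. intros ->. apply vnorm_triangle. Qed.

Lemma vnorm_diff x y z : x = vsub y z -> vnorm x <= vnorm y + vnorm z.
Proof. intros ->. unfold vsub. rewrite <- (vnorm_opp z). apply vnorm_triangle. Qed.

Lemma vnorm_sub_sym x y : vnorm (vsub x y) = vnorm (vsub y x).
Proof. rewrite <- vnorm_opp. f_equal. vlin. Qed.

Lemma vnorm_pos x : x <> vzero -> 0 < vnorm x.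
Proof.
  intros H. destruct (Rle_lt_or_eq_dec 0 (vnorm x) (vnorm_nonneg x)) as [|E]; auto.
  now destruct H; apply vnorm_eq0.
Qed.

Lemma vsub_eq0 x y : vsub x y = vzero -> x = y.
Proof.
  intros H. transitivity (vadd (vsub x y) y); [vlin|]. rewrite H. vlin.
Qed.

Lemma vsub_0_r x : vsub x vzero = x.
Proof. vlin. Qed.

Lemma vnorm_scal_pos a x : 0 <= a -> vnorm (vscal a x) = a * vnorm x.
Proof. intros H. rewrite vnorm_scal, Rabs_right; lra. Qed.

End NormFacts.

Section Linear.
Context {X Y : NormedSpace} (f : X -> Y) (Hf : is_linear f).

Lemma linear_zero : f vzero = vzero.
Proof. rewrite <- (vscal_0l vzero), (proj2 Hf), vscal_0l. reflexivity. Qed.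

Lemma linear_sub x y : f (vsub x y) = vsub (f x) (f y).
Proof. unfold vsub. rewrite !vopp_scal, (proj1 Hf), (proj2 Hf). reflexivity. Qed.

End Linear.

(** * Properties of all large indices, and Delta-convergence in these terms *)

Definition ev (P : nat -> Prop) : Prop := exists N, forall k, (N <= k)%nat -> P k.

Lemma ev_all (P : nat -> Prop) : (forall k, P k) -> ev P.
Proof. intros H; exists 0%nat; auto. Qed.

Lemma ev_ge N : ev (fun k => (N <= k)%nat).
Proof. now exists N. Qed.

Lemma ev_imp (P Q : nat -> Prop) : ev P -> (forall k, P k -> Q k) -> ev Q.
Proof. intros [N H] HI; exists N; auto. Qed.

Lemma ev_and (P Q : nat -> Prop) : ev P -> ev Q -> ev (fun k => P k /\ Q k).
Proof.
  intros [N H] [M K]; exists (max N M); intros k Hk; split; [apply H | apply K]; lia.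
Qed.

Lemma ev_imp2 (P Q S : nat -> Prop) :
  ev P -> ev Q -> (forall k, P k -> Q k -> S k) -> ev S.
Proof. intros H K HI. apply (ev_imp _ _ (ev_and _ _ H K)). intros k []; auto. Qed.

Lemma ev_imp3 (P Q S T : nat -> Prop) :
  ev P -> ev Q -> ev S -> (forall k, P k -> Q k -> S k -> T k) -> ev T.
Proof.
  intros H K L HI. apply (ev_imp2 _ _ _ (ev_and _ _ H K) L). intros k []; auto.
Qed.

Lemma ev_ex (P : nat -> Prop) : ev P -> exists k, P k.
Proof. intros [N H]; exists N; auto. Qed.

Lemma ev_forall_lt (P : nat -> nat -> Prop) M :
  (forall n, (n < M)%nat -> ev (P n)) -> ev (fun k => forall n, (n < M)%nat -> P n k).
Proof.
  induction M as [|M IH]; intros H.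
  - apply ev_all. intros; lia.
  - apply (ev_imp2 _ _ _ (IH (fun n Hn => H n (Nat.lt_trans _ _ _ Hn (Nat.lt_succ_diag_r M)))) (H M (Nat.lt_succ_diag_r M))).
    intros k H1 H2 n Hn. destruct (Nat.eq_dec n M) as [->|]; auto. apply H1; lia.
Qed.

Lemma not_ev (P : nat -> Prop) : ~ ev P -> forall N, exists k, (N <= k)%nat /\ ~ P k.
Proof.
  intros H N. apply NNPP. intros K. apply H. exists N. intros k Hk.
  apply NNPP. intros L. apply K. eauto.
Qed.

Lemma Un_cv_ev (a : nat -> R) l : Un_cv a l <-> forall eps, eps > 0 -> ev (fun k => Rabs (a k - l) < eps).
Proof.
  split; intros H eps He; destruct (H eps He) as [N HN]; exists N; intros k Hk; apply HN; lia.
Qed.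

Lemma norm_cv_ev {X : NormedSpace} (x : nat -> X) l :
  norm_cv x l <-> forall eps, eps > 0 -> ev (fun k => vnorm (vsub (x k) l) < eps).
Proof.
  unfold norm_cv. rewrite Un_cv_ev.
  split; intros H eps He; apply (ev_imp _ _ (H eps He)); intros k Hk.
  - rewrite Rminus_0_r in Hk. apply Rabs_def2 in Hk. lra.
  - rewrite Rminus_0_r, Rabs_right; auto. apply Rle_ge, vnorm_nonneg.
Qed.

Lemma limsup_le0_ev (a : nat -> R) : limsup_le0 a <-> forall eps, eps > 0 -> ev (fun k => a k <= eps).
Proof. split; intros H eps He; destruct (H eps He) as [N HN]; exists N; intros k Hk; apply HN; lia. Qed.

Lemma delta_cv_ev {X : NormedSpace} (x : nat -> X) l :
  delta_cv x l <->
  forall y eps, eps > 0 -> ev (fun k => vnorm (vsub (x k) l) <= vnorm (vsub (x k) y) + eps).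
Proof.
  split.
  - intros H y eps He. apply (ev_imp _ _ (proj1 (limsup_le0_ev _) (H y) eps He)). intros; lra.
  - intros H y. apply limsup_le0_ev. intros eps He. apply (ev_imp _ _ (H y eps He)). intros; lra.
Qed.

(** The working form of Delta-nullity: no fixed vector, when added, shortens the sequence
    asymptotically. *)
Lemma delta_cv0_ev {X : NormedSpace} (x : nat -> X) :
  delta_cv x vzero <->
  forall y eps, eps > 0 -> ev (fun k => vnorm (x k) <= vnorm (vadd (x k) y) + eps).
Proof.
  rewrite delta_cv_ev. split; intros H y eps He; apply (ev_imp _ _ (H (vopp y) eps He)); intros k Hk.
  - rewrite vsub_0_r in Hk. replace (vadd (x k) y) with (vsub (x k) (vopp y)) by vlin. exact Hk.
  - rewrite vsub_0_r. exact Hk.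
Qed.

Lemma delta_cv_shift {X : NormedSpace} (x : nat -> X) l :
  delta_cv x l -> delta_cv (fun k => vsub (x k) l) vzero.
Proof.
  rewrite delta_cv_ev, delta_cv0_ev. intros H y eps He.
  apply (ev_imp _ _ (H (vsub l y) eps He)). intros k Hk.
  replace (vadd (vsub (x k) l) y) with (vsub (x k) (vsub l y)) by vlin. exact Hk.
Qed.

Lemma delta_cv_ev_eq {X : NormedSpace} (x y : nat -> X) l :
  ev (fun k => x k = y k) -> delta_cv x l -> delta_cv y l.
Proof.
  rewrite !delta_cv_ev. intros E H z eps He.
  apply (ev_imp2 _ _ _ E (H z eps He)). intros k <-. auto.
Qed.

Lemma weak_cv_ev_eq {X : NormedSpace} (x y : nat -> X) l :
  ev (fun k => x k = y k) -> weak_cv x l -> weak_cv y l.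
Proof.
  intros E H f Hf. apply Un_cv_ev. intros eps He.
  apply (ev_imp2 _ _ _ E (proj1 (Un_cv_ev _ _) (H f Hf) eps He)). intros k <-. auto.
Qed.

(** Only values are compared; [sub_index] recovers the index map from monotonicity. The relation is
    then transitive at once and fits the tails of a diagonal sequence. *)
Definition sub (s phi : nat -> nat) : Prop :=
  strictly_incr s /\ forall j, exists i, s j = phi i.

Lemma strictly_incr_lt phi : strictly_incr phi -> forall i j, (i < j)%nat -> (phi i < phi j)%nat.
Proof.
  intros H i j Hij. induction Hij as [|j Hij IH]; [apply H|].
  specialize (H j). lia.
Qed.

Lemma strictly_incr_inj phi : strictly_incr phi -> forall i j, phi i = phi j -> i = j.
Proof.
  intros H i j E. destruct (Nat.lt_trichotomy i j) as [L|[L|L]]; auto;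
    apply (strictly_incr_lt _ H) in L; lia.
Qed.

Lemma strictly_incr_ge phi : strictly_incr phi -> forall i, (i <= phi i)%nat.
Proof. intros H i. induction i as [|i IH]; [lia|]. specialize (H i). lia. Qed.

Lemma strictly_incr_comp phi psi :
  strictly_incr phi -> strictly_incr psi -> strictly_incr (fun k => phi (psi k)).
Proof. intros H K n. apply strictly_incr_lt; auto. Qed.

Lemma sub_refl phi : strictly_incr phi -> sub phi phi.
Proof. intros H; split; auto. intros j; now exists j. Qed.

Lemma sub_comp phi psi : strictly_incr phi -> strictly_incr psi -> sub (fun k => phi (psi k)) phi.
Proof. intros H K; split; [now apply strictly_incr_comp|]. intros j; now exists (psi j). Qed.

Lemma sub_trans a b c : sub a b -> sub b c -> sub a c.
Proof.
  intros [Ha H] [_ K]; split; auto. intros j. destruct (H j) as [i ->]. apply K.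
Qed.

Lemma sub_index s phi : strictly_incr phi -> sub s phi -> forall j, exists i, (j <= i)%nat /\ s j = phi i.
Proof.
  intros Hp [Hs H] j. induction j as [|j [i [Hi E]]].
  - destruct (H 0%nat) as [i E]; exists i; split; [lia|auto].
  - destruct (H (S j)) as [i' E']. exists i'. split; auto.
    assert (i < i')%nat; [|lia].
    destruct (Nat.lt_ge_cases i i') as [|L]; auto.
    assert (phi i' <= phi i)%nat by (destruct (Nat.eq_dec i i') as [->|]; [lia|]; apply Nat.lt_le_incl, strictly_incr_lt; auto; lia).
    specialize (Hs j). lia.
Qed.

Lemma ev_sub (P : nat -> Prop) phi s :
  strictly_incr phi -> sub s phi -> ev (fun k => P (phi k)) -> ev (fun k => P (s k)).
Proof.
  intros Hp Hs [N HN]. exists N. intros k Hk.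
  destruct (sub_index _ _ Hp Hs k) as [i [Hi ->]]. apply HN; lia.
Qed.

Lemma ev_sub1 (P : nat -> Prop) s : strictly_incr s -> ev P -> ev (fun k => P (s k)).
Proof.
  intros Hs [N HN]. exists N. intros k Hk. apply HN. pose proof (strictly_incr_ge _ Hs k). lia.
Qed.

Lemma frequently_subseq (P : nat -> Prop) :
  (forall N, exists k, (N <= k)%nat /\ P k) -> exists s, strictly_incr s /\ forall j, P (s j).
Proof.
  intros H.
  destruct (choice (fun N k => (N <= k)%nat /\ P k) H) as [f Hf].
  exists (fix s j := match j with O => f O | S j => f (S (s j)) end).
  split.
  - intros j. destruct (Hf (S ((fix s j := match j with O => f O | S j => f (S (s j)) end) j))).
    simpl. lia.
  - intros [|j]; apply Hf.
Qed.

Lemma not_ev_subseq (P : nat -> Prop) :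
  ~ ev P -> exists s, strictly_incr s /\ forall j, ~ P (s j).
Proof. intros H. apply (frequently_subseq (fun k => ~ P k)). now apply not_ev. Qed.

Lemma delta_cv_sub {X : NormedSpace} (x : nat -> X) l phi s :
  strictly_incr phi -> sub s phi ->
  delta_cv (fun k => x (phi k)) l -> delta_cv (fun k => x (s k)) l.
Proof.
  rewrite !delta_cv_ev. intros Hp Hs H y eps He.
  exact (ev_sub (fun i => vnorm (vsub (x i) l) <= vnorm (vsub (x i) y) + eps) _ _ Hp Hs (H y eps He)).
Qed.

Lemma delta_cv_sub1 {X : NormedSpace} (x : nat -> X) l s :
  strictly_incr s -> delta_cv x l -> delta_cv (fun k => x (s k)) l.
Proof.
  intros Hs. apply (delta_cv_sub x l (fun k => k) s); [intros n; lia|].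
  split; auto. intros j; now exists (s j).
Qed.

Lemma Un_cv_sub (a : nat -> R) l phi s :
  strictly_incr phi -> sub s phi ->
  Un_cv (fun k => a (phi k)) l -> Un_cv (fun k => a (s k)) l.
Proof.
  rewrite !Un_cv_ev. intros Hp Hs H eps He.
  exact (ev_sub (fun i => Rabs (a i - l) < eps) _ _ Hp Hs (H eps He)).
Qed.

Lemma Un_cv_sub1 (a : nat -> R) l s :
  strictly_incr s -> Un_cv a l -> Un_cv (fun k => a (s k)) l.
Proof.
  intros Hs. apply (Un_cv_sub a l (fun k => k) s); [intros n; lia|].
  split; auto. intros j; now exists (s j).
Qed.

(** The term of index j + n is taken from stage j + n, which refines stage n. Only this tail lies in
    stage n, hence the shift. *)
Lemma diagonal (phi : nat -> nat -> nat) :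
  (forall n, strictly_incr (phi n)) -> (forall n, sub (phi (S n)) (phi n)) ->
  exists d, strictly_incr d /\ forall n, sub (fun j => d (j + n)%nat) (phi n).
Proof.
  intros Hi Hs.
  assert (T : forall n m, sub (phi (m + n)%nat) (phi n)).
  { intros n m; induction m as [|m IH]; [now apply sub_refl|].
    exact (sub_trans _ _ _ (Hs _) IH). }
  assert (Hd : strictly_incr (fun n => phi n n)).
  { intros n. destruct (sub_index _ _ (Hi n) (Hs n) (S n)) as [i [L ->]].
    apply strictly_incr_lt; auto. }
  exists (fun n => phi n n). split; auto.
  intros n; split; [intros j; apply (Hd (j + n)%nat)|].
  intros j. apply (proj2 (T n j)).
Qed.

Lemma sub_shift_ev (P : nat -> Prop) d n :
  ev (fun j => P (d (j + n)%nat)) -> ev (fun j => P (d j)).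
Proof.
  intros [N H]. exists (N + n)%nat. intros k Hk.
  replace k with (k - n + n)%nat by lia. apply H. lia.
Qed.

Lemma bounded_real_subseq (a : nat -> R) C :
  (forall k, Rabs (a k) <= C) -> exists s l, strictly_incr s /\ Un_cv (fun k => a (s k)) l.
Proof.
  intros H.
  destruct (Bolzano_Weierstrass a (fun c => -C <= c <= C) (compact_P3 (-C) C)) as [l Hl].
  { intros n. specialize (H n). unfold Rabs in H. destruct (Rcase_abs (a n)); lra. }
  assert (K : forall j N, exists k, (N <= k)%nat /\ Rabs (a k - l) < / INR (S j)).
  { intros j N. assert (Hp : 0 < / INR (S j)) by (apply Rinv_0_lt_compat, lt_0_INR; lia).
    destruct (Hl (disc l (mkposreal _ Hp)) N) as [k [Hk1 Hk2]].
    - exists (mkposreal _ Hp). intros z Hz; exact Hz.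
    - exists k. split; auto. }
  destruct (choice (fun (p : nat * nat) k => (snd p <= k)%nat /\ Rabs (a k - l) < / INR (S (fst p)))) as [f Hf].
  { intros [j N]; apply K. }
  set (s := fix s j := match j with O => f (O, O) | S i => f (j, S (s i)) end).
  assert (Hs : strictly_incr s).
  { intros j. simpl. destruct (Hf (S j, S (s j))). simpl in *. lia. }
  exists s, l. split; auto.
  apply Un_cv_ev. intros eps He.
  destruct (archimed_cor1 eps He) as [N [HN HN0]]. exists N. intros k Hk.
  assert (B : Rabs (a (s k) - l) < / INR (S k)).
  { destruct k; simpl s; [apply (Hf (O, O))|apply (Hf (S k, S (s k)))]. }
  apply (Rlt_trans _ _ _ B). apply (Rle_lt_trans _ (/ INR N)); auto.
  apply Rinv_le_contravar; [apply lt_0_INR; lia|apply le_INR; lia].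
Qed.

(** * Uniform convexity and Delta-convergence *)

Lemma glb_exists (S : R -> Prop) b : (exists s, S s) -> (forall s, S s -> b <= s) -> exists m, is_glb S m.
Proof.
  intros [s0 H0] Hb.
  destruct (completeness (fun t => S (- t))) as [m [Hm1 Hm2]].
  - exists (- b). intros t Ht. specialize (Hb _ Ht). lra.
  - exists (- s0). now rewrite Ropp_involutive.
  - exists (- m). split.
    + intros s Hs. assert (- s <= m); [|lra]. apply Hm1. now rewrite Ropp_involutive.
    + intros c Hc. assert (m <= - c); [|lra]. apply Hm2. intros t Ht. specialize (Hc _ Ht). lra.
Qed.

Lemma glb_approx (S : R -> Prop) m eps : is_glb S m -> eps > 0 -> exists s, S s /\ s < m + eps.
Proof.
  intros [_ H] He. apply NNPP. intros K.
  assert (m + eps <= m); [|lra]. apply H. intros s Hs.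
  apply Rnot_lt_le. intros L. apply K. eauto.
Qed.

Lemma inv_INR_small eps : eps > 0 -> exists N, forall n, (N <= n)%nat -> / INR (S n) < eps.
Proof.
  intros He. destruct (archimed_cor1 eps He) as [N [HN HN0]]. exists N. intros n Hn.
  apply (Rle_lt_trans _ (/ INR N)); auto.
  apply Rinv_le_contravar; [apply lt_0_INR; lia|apply le_INR; lia].
Qed.

Lemma inv_INR_pos n : 0 < / INR (S n).
Proof. apply Rinv_0_lt_compat, lt_0_INR; lia. Qed.

Lemma dependent_choice {A} (P : A -> Prop) (Q : nat -> A -> A -> Prop) a0 :
  P a0 -> (forall n a, P a -> exists b, P b /\ Q n a b) ->
  exists f : nat -> A, f O = a0 /\ forall n, P (f n) /\ Q n (f n) (f (S n)).
Proof.
  intros H0 H.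
  destruct (choice (fun (p : nat * A) b => P (snd p) -> P b /\ Q (fst p) (snd p) b)) as [F HF].
  { intros [n a]. simpl. destruct (classic (P a)) as [Ha|Ha].
    - destruct (H n a Ha) as [b Hb]; now exists b.
    - exists a; tauto. }
  set (f := fix f n := match n with O => a0 | S n => F (n, f n) end).
  assert (HP : forall n, P (f n)).
  { induction n as [|n IH]; [exact H0|]. apply (HF (n, f n) IH). }
  exists f. split; auto. intros n. split; auto. apply (HF (n, f n) (HP n)).
Qed.

Section UniformConvexity.
Context {X : NormedSpace}.
Implicit Types x y z : X.

Definition mid x y : X := vscal (1/2) (vadd x y).

(* Translating both points by the same vector along their midpoint reduces a small ball to the unit ball without changing their difference. *)
Lemma midpoint_push x y R :
  (exists e : X, vnorm e = 1) -> R <= 1 -> vnorm x <= R -> vnorm y <= R ->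
  exists x' y', vnorm x' <= 1 /\ vnorm y' <= 1 /\ vsub x' y' = vsub x y /\
    vnorm (mid x' y') = vnorm (mid x y) + (1 - R).
Proof.
  intros [e0 He0] HR Hx Hy.
  assert (He : exists e a, vnorm e = 1 /\ 0 <= a /\ mid x y = vscal a e).
  { destruct (classic (mid x y = vzero)) as [E|E].
    - exists e0, 0. rewrite vscal_0l. repeat split; auto; lra.
    - apply vnorm_pos in E. exists (vscal (/ vnorm (mid x y)) (mid x y)), (vnorm (mid x y)).
      assert (0 < / vnorm (mid x y)) by now apply Rinv_0_lt_compat.
      split; [|split; [lra|]].
      { rewrite vnorm_scal_pos by lra. field. lra. }
      rewrite <- vscal_mul. rewrite Rinv_r by lra. now rewrite vscal_1. }
  destruct He as (e & a & He & Ha & E).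
  exists (vadd x (vscal (1 - R) e)), (vadd y (vscal (1 - R) e)).
  repeat split.
  - eapply Rle_trans; [apply vnorm_triangle|]. rewrite vnorm_scal_pos, He; lra.
  - eapply Rle_trans; [apply vnorm_triangle|]. rewrite vnorm_scal_pos, He; lra.
  - vlin.
  - replace (mid (vadd x (vscal (1 - R) e)) (vadd y (vscal (1 - R) e)))
      with (vadd (mid x y) (vscal (1 - R) e)) by (unfold mid; vlin).
    rewrite E. replace (vadd (vscal a e) (vscal (1 - R) e)) with (vscal (a + (1 - R)) e) by vlin.
    rewrite !vnorm_scal_pos, He; lra.
Qed.

Lemma unit_vector x : x <> vzero -> exists e : X, vnorm e = 1.
Proof.
  intros H. apply vnorm_pos in H. exists (vscal (/ vnorm x) x).
  assert (0 < / vnorm x) by now apply Rinv_0_lt_compat.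
  rewrite vnorm_scal_pos; [field|]; lra.
Qed.

(** Uniform convexity for balls of every radius up to [C], with one gap [d] for all of them: later
    the radius varies with k. Dividing by [C] brings the radius below 1, where [midpoint_push]
    applies. *)
Lemma midpoint_gap (HUC : uniformly_convex X) C eps : C > 0 -> eps > 0 ->
  exists d, d > 0 /\ forall R x y, R <= C -> vnorm x <= R -> vnorm y <= R ->
    eps <= vnorm (vsub x y) -> vnorm (mid x y) <= R - d.
Proof.
  intros HC He.
  assert (HeC : 0 < eps / C) by (apply Rdiv_lt_0_compat; lra).
  (* Uniform convexity is stated for separations of at most 2, hence the minimum. *)
  destruct (HUC (Rmin (eps / C) 2)) as [d [Hd H]].
  { split; [apply Rmin_glb_lt; lra|apply Rmin_r]. }
  exists (C * d). split; [nra|].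
  intros R x y HR Hx Hy Hxy.
  assert (HiC : 0 < / C) by now apply Rinv_0_lt_compat.
  destruct (midpoint_push (vscal (/ C) x) (vscal (/ C) y) (/ C * R)) as (x' & y' & Hx' & Hy' & Hs & Hm).
  - apply (unit_vector (vsub x y)). intros E. rewrite E, vnorm_zero in Hxy. lra.
  - replace 1 with (/ C * C) by (field; lra). apply Rmult_le_compat_l; lra.
  - rewrite vnorm_scal_pos by lra. apply Rmult_le_compat_l; lra.
  - rewrite vnorm_scal_pos by lra. apply Rmult_le_compat_l; lra.
  - assert (K := H x' y' Hx' Hy'). rewrite Hs in K.
    replace (vsub (vscal (/ C) x) (vscal (/ C) y)) with (vscal (/ C) (vsub x y)) in K by vlin.
    rewrite vnorm_scal_pos in K by lra.
    assert (K' : vnorm (mid x' y') <= 1 - d).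
    { apply K. apply Rle_ge. eapply Rle_trans; [apply Rmin_l|].
      unfold Rdiv. rewrite Rmult_comm. apply Rmult_le_compat_l; lra. }
    rewrite Hm in K'.
    replace (mid (vscal (/ C) x) (vscal (/ C) y)) with (vscal (/ C) (mid x y)) in K' by (unfold mid; vlin).
    rewrite vnorm_scal_pos in K' by lra.
    apply (Rmult_le_reg_l (/ C)); [lra|].
    replace (/ C * (R - C * d)) with (/ C * R - d) by (field; lra). lra.
Qed.

(** As [modconv] is a choice among greatest lower bounds, one has to exist: the given pair shows the
    set nonempty, and 0 bounds it below. *)
Lemma modconv_le x y t : vnorm x <= 1 -> vnorm y <= 1 -> t <= vnorm (vsub x y) ->
  modconv X t <= 1 - vnorm (mid x y).
Proof.
  intros Hx Hy Ht.
  assert (M : modconv_set X t (1 - vnorm (mid x y))).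
  { exists x, y. repeat split; auto; lra. }
  destruct (epsilon_spec (inhabits 0) (fun d => is_glb (modconv_set X t) d)) as [K _].
  - apply (glb_exists _ 0); [eauto|]. intros s (a & b & Ha & Hb & _ & ->).
    assert (vnorm (mid a b) <= 1); [|fold (mid a b); lra].
    unfold mid. rewrite vnorm_scal_pos by lra. pose proof (vnorm_triangle X a b). lra.
  - now apply K.
Qed.

(** In a ball of radius [R] at most 1 the full [modconv X t] is gained, without rescaling [t],
    because [midpoint_push] keeps the difference of the points. The energy bound owes its form to
    this. *)
Lemma modconv_ball x y t R : 0 < t -> R <= 1 -> vnorm x <= R -> vnorm y <= R ->
  t <= vnorm (vsub x y) -> vnorm (mid x y) <= R - modconv X t.
Proof.
  intros Ht HR Hx Hy Hxy.
  destruct (midpoint_push x y R) as (x' & y' & Hx' & Hy' & Hs & Hm); auto.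
  { apply (unit_vector (vsub x y)). intros E. rewrite E, vnorm_zero in Hxy. lra. }
  assert (K := modconv_le x' y' t Hx' Hy'). rewrite Hs in K. specialize (K Hxy). lra.
Qed.

End UniformConvexity.

Section DeltaConvergence.
Context {X : NormedSpace} (HB : Banach X) (HUC : uniformly_convex X).

(* The limit is the common asymptotic centre of all subsequences of a subsequence along which the asymptotic radius is as large as possible. *)
Lemma delta_compact (x : nat -> X) : bounded_seq x ->
  exists phi l, strictly_incr phi /\ delta_cv (fun k => x (phi k)) l.
Proof.
  intros [C HC].
  (* The infimum of [radii phi] is the least asymptotic radius among the subsequences of [phi], over
     all centres; it can only grow under refinement. *)
  set (radii := fun phi R => exists y s, sub s phi /\ ev (fun k => vnorm (vsub (x (s k)) y) <= R)).
  assert (Hrad : forall phi, strictly_incr phi -> exists m, is_glb (radii phi) m).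
  { intros phi Hp. apply (glb_exists _ 0).
    - exists C, vzero, phi. split; [now apply sub_refl|]. apply ev_all. intros k. now rewrite vsub_0_r.
    - intros s (y & s' & _ & H). apply ev_ex in H. destruct H as [k Hk]; cbv beta in Hk.
      pose proof (vnorm_nonneg (vsub (x (s' k)) y)). lra. }
  destruct (dependent_choice (A := (nat -> nat) * X) (fun a => strictly_incr (fst a))
    (fun n a b => sub (fst b) (fst a) /\ exists m, is_glb (radii (fst a)) m /\
       ev (fun k => vnorm (vsub (x (fst b k)) (snd b)) <= m + / INR (S n)))
    (fun n => n, vzero)) as [f [_ Hf]].
  { intros n; simpl; lia. }
  { intros n [phi y0] Hp. cbn [fst snd] in *. destruct (Hrad phi Hp) as [m Hm].
    destruct (glb_approx _ _ _ Hm (inv_INR_pos n)) as (R & (y & s & Hs & HR) & HRm).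
    exists (s, y). cbn [fst snd]. split; [apply Hs|]. split; auto. exists m. split; auto.
    apply (ev_imp _ _ HR). intros; lra. }
  destruct (choice (fun n m => is_glb (radii (fst (f n))) m /\
     ev (fun k => vnorm (vsub (x (fst (f (S n)) k)) (snd (f (S n)))) <= m + / INR (S n)))) as [m Hm].
  { intros n. apply Hf. }
  set (y := fun n => snd (f (S n))).
  destruct (diagonal (fun n => fst (f n))) as [d [Hd Hds]]; [apply Hf|apply Hf|].
  (* Beyond its first n terms a subsequence of [d] refines stage n, so no centre gives it a radius
     below [m n]. *)
  assert (Low : forall n z s R, sub s d -> ev (fun k => vnorm (vsub (x (s k)) z) <= R) -> m n <= R).
  { intros n z s R Hs HR. apply (proj1 (Hm n)).
    exists z, (fun j => s (j + n)%nat). split; [split|].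
    - intros j. apply (proj1 Hs).
    - intros j. destruct (sub_index _ _ Hd Hs (j + n)) as [i [Hi E]]. rewrite E.
      destruct (proj2 (Hds n) (i - n)%nat) as [i' E'].
      exists i'. rewrite <- E'. f_equal. lia.
    - destruct HR as [N HN]. exists N. intros k Hk. apply HN. lia. }
  assert (Up : forall n, ev (fun k => vnorm (vsub (x (d k)) (y n)) <= m n + / INR (S n))).
  { intros n. apply (sub_shift_ev (fun i => vnorm (vsub (x i) (y n)) <= m n + / INR (S n)) d (S n)).
    apply (ev_sub (fun i => vnorm (vsub (x i) (y n)) <= m n + / INR (S n)) (fst (f (S n)))).
    - apply Hf.
    - apply Hds.
    - apply Hm. }
  destruct (completeness (fun a => exists n, a = m n)) as [ms [Hms1 Hms2]].
  { exists C. intros a [n ->]. apply (Low n vzero d); [now apply sub_refl|].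
    apply ev_all. intros k. now rewrite vsub_0_r. }
  { exists (m O), O; auto. }
  assert (Low' : forall z s R, sub s d -> ev (fun k => vnorm (vsub (x (s k)) z) <= R) -> ms <= R).
  { intros z s R Hs HR. apply Hms2. intros a [n ->]. eapply Low; eauto. }
  assert (Up' : forall n, ev (fun k => vnorm (vsub (x (d k)) (y n)) <= ms + / INR (S n))).
  { intros n. apply (ev_imp _ _ (Up n)). intros k Hk.
    assert (m n <= ms) by (apply Hms1; eauto). lra. }
  assert (Hms0 : 0 <= ms).
  { apply (Rle_trans _ (m O)); [|apply Hms1; eauto].
    apply (proj2 (proj1 (Hm O))). intros s (z & s' & _ & H). apply ev_ex in H. destruct H as [k Hk]; cbv beta in Hk.
    pose proof (vnorm_nonneg (vsub (x (s' k)) z)). lra. }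
  destruct (HB y) as [l Hl].
  { intros eps He.
    destruct (midpoint_gap HUC (ms + 1) eps) as (gap & Hg & G); [lra|auto|].
    destruct (inv_INR_small (Rmin gap 1)) as [N HN]; [apply Rmin_glb_lt; lra|].
    exists N. intros i j Hi Hj. apply Rnot_le_lt. intros L.
    assert (HNN := HN N (Nat.le_refl _)).
    assert (Hmono : forall n, (n >= N)%nat -> / INR (S n) <= / INR (S N)).
    { intros n Hn. apply Rinv_le_contravar; [apply lt_0_INR; lia|apply le_INR; lia]. }
    (* The midpoint of two distant centres would be a centre of radius below [ms], which [Low']
       forbids. *)
    assert (ms <= ms + / INR (S N) - gap).
    { apply (Low' (mid (y i) (y j)) d); [now apply sub_refl|].
      apply (ev_imp2 _ _ _ (Up' i) (Up' j)). intros k Hki Hkj.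
      replace (vsub (x (d k)) (mid (y i) (y j)))
        with (mid (vsub (x (d k)) (y i)) (vsub (x (d k)) (y j))) by (unfold mid; vlin).
      specialize (Hmono i Hi) as Mi. specialize (Hmono j Hj) as Mj.
      apply G; try lra.
      - pose proof (Rmin_r gap 1). lra.
      - replace (vsub (vsub (x (d k)) (y i)) (vsub (x (d k)) (y j))) with (vsub (y j) (y i)) by vlin.
        rewrite vnorm_sub_sym. exact L. }
    pose proof (Rmin_l gap 1). lra. }
  exists d, l. split; auto.
  apply delta_cv_ev. intros z eps He.
  assert (A : ev (fun k => vnorm (vsub (x (d k)) l) <= ms + eps / 2)).
  { destruct (inv_INR_small (eps / 4)) as [N HN]; [lra|].
    destruct (ev_ex _ (ev_and _ _ (ev_ge N) (proj1 (norm_cv_ev _ _) Hl (eps / 4) ltac:(lra)))) as [n [Hn Hnl]].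
    apply (ev_imp _ _ (Up' n)). intros k Hk. specialize (HN n Hn).
    pose proof (vnorm_sum (vsub (x (d k)) l) (vsub (x (d k)) (y n)) (vsub (y n) l) ltac:(vlin)). lra. }
  assert (B : ev (fun k => ms - eps / 2 <= vnorm (vsub (x (d k)) z))).
  { apply NNPP. intros K. destruct (not_ev_subseq _ K) as [s [Hs Hs']].
    assert (ms <= ms - eps / 2); [|lra].
    apply (Low' z (fun j => d (s j))); [now apply sub_comp|].
    apply ev_all. intros k. specialize (Hs' k). lra. }
  apply (ev_imp2 _ _ _ A B). intros; lra.
Qed.

(** Comparing the centre [l] with the centre 0 bounds the distance from [x k] to [l] by [C] up to a
    small error; the triangle inequality then costs the factor 2. *)
Lemma delta_limit_bound (x : nat -> X) l C :
  delta_cv x l -> ev (fun k => vnorm (x k) <= C) -> vnorm l <= 2 * C.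
Proof.
  rewrite delta_cv_ev. intros H HC. apply Rnot_lt_le. intros L.
  destruct (ev_ex _ (ev_and _ _ HC (H vzero ((vnorm l - 2 * C) / 2) ltac:(lra)))) as [k [K1 K2]].
  rewrite vsub_0_r in K2.
  pose proof (vnorm_diff l (x k) (vsub (x k) l) ltac:(vlin)). lra.
Qed.

(** If [w] and [v] were far apart, both would be nearly equally good centres for [x], since [v] is
    optimal for the nearby [y]. Their midpoint would then beat [w], the optimal centre for [x]. *)
Lemma delta_limit_perturb C eta : C > 0 -> eta > 0 ->
  exists eps, eps > 0 /\ forall (x y : nat -> X) w v,
    ev (fun k => vnorm (x k) <= C) -> delta_cv x w -> delta_cv y v ->
    ev (fun k => vnorm (vsub (x k) (y k)) <= eps) -> vnorm (vsub w v) < eta.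
Proof.
  intros HC He.
  (* As [w] has norm at most 2 C, the distance from [x k] to [w] is at most 3 C; three errors of at
     most 1 come on top. *)
  destruct (midpoint_gap HUC (3 * C + 4) eta) as (d & Hd & G); [lra|auto|].
  set (e := Rmin 1 (d / 10)).
  assert (He0 : e > 0) by (apply Rmin_glb_lt; lra).
  assert (He1 : e <= 1) by apply Rmin_l.
  assert (Hed : e <= d / 10) by apply Rmin_r.
  exists e. split; auto.
  intros x y w v Hx Hxw Hyv Hxy.
  apply Rnot_le_lt. intros L.
  assert (Hw := delta_limit_bound _ _ _ Hxw Hx).
  rewrite delta_cv_ev in Hxw, Hyv.
  assert (A := ev_and _ _ (Hxw (mid w v) e He0) (ev_and _ _ (Hyv w e He0) (ev_and _ _ Hx Hxy))).
  destruct (ev_ex _ A) as (k & K1 & K2 & K3 & K4).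
  pose proof (vnorm_sum (vsub (x k) v) (vsub (y k) v) (vsub (x k) (y k)) ltac:(vlin)).
  pose proof (vnorm_diff (vsub (y k) w) (vsub (x k) w) (vsub (x k) (y k)) ltac:(vlin)).
  pose proof (vnorm_diff (vsub (x k) w) (x k) w ltac:(vlin)).
  assert (M := G (vnorm (vsub (x k) w) + 3 * e) (vsub (x k) w) (vsub (x k) v) ltac:(lra) ltac:(lra) ltac:(lra)).
  replace (mid (vsub (x k) w) (vsub (x k) v)) with (vsub (x k) (mid w v)) in M by (unfold mid; vlin).
  replace (vsub (vsub (x k) w) (vsub (x k) v)) with (vsub v w) in M by vlin.
  rewrite vnorm_sub_sym in M. specialize (M L). lra.
Qed.

Lemma delta_limit_unique (x : nat -> X) w v :
  bounded_seq x -> delta_cv x w -> delta_cv x v -> w = v.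
Proof.
  intros [C HC] Hw Hv. apply vsub_eq0, vnorm_eq0.
  apply Rle_antisym; [|apply vnorm_nonneg]. apply Rnot_lt_le. intros L.
  assert (HC0 : 0 <= C) by (eapply Rle_trans; [apply (vnorm_nonneg (x O))|apply HC]).
  destruct (delta_limit_perturb (C + 1) (vnorm (vsub w v))) as (e & He & H); [lra|auto|].
  assert (K := H x x w v). apply (Rlt_irrefl (vnorm (vsub w v))), K; auto.
  - apply ev_all. intros k. specialize (HC k). lra.
  - apply ev_all. intros k. replace (vsub (x k) (x k)) with (vzero : X) by vlin. rewrite vnorm_zero. lra.
Qed.

End DeltaConvergence.

(** * Extraction of profiles *)

Fixpoint vsum {X : NormedSpace} (f : nat -> X) (M : nat) : X :=
  match M with
  | O => vzero
  | S M => vadd (vsum f M) (f M)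
  end.

(** Subsums are sums over an initial segment with masked terms, so that splitting and truncating
    become termwise. *)
Definition vsel {X : NormedSpace} (b : bool) (x : X) : X := if b then x else vzero.

Section FiniteSums.
Context {X : NormedSpace}.

Lemma vsum_ext (f g : nat -> X) M : (forall n, (n < M)%nat -> f n = g n) -> vsum f M = vsum g M.
Proof.
  induction M as [|M IH]; intros H; simpl; auto. rewrite IH, H; auto.
Qed.

Lemma vsum_zero (f : nat -> X) M : (forall n, (n < M)%nat -> f n = vzero) -> vsum f M = vzero.
Proof.
  induction M as [|M IH]; intros H; simpl; auto. rewrite IH, H; auto. apply vadd_0.
Qed.

Lemma vsum_add (f g : nat -> X) M :
  vsum (fun n => vadd (f n) (g n)) M = vadd (vsum f M) (vsum g M).
Proof. induction M as [|M IH]; simpl; [vlin|]. rewrite IH. vlin. Qed.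

Lemma vsum_scal a (f : nat -> X) M : vsum (fun n => vscal a (f n)) M = vscal a (vsum f M).
Proof. induction M as [|M IH]; simpl; [vlin|]. rewrite IH. vlin. Qed.

Lemma vsum_split (p q : nat -> bool) (f : nat -> X) M :
  (forall n, (n < M)%nat -> p n = true -> q n = true) ->
  vsum (fun n => vsel (q n) (f n)) M =
  vadd (vsum (fun n => vsel (p n) (f n)) M) (vsum (fun n => vsel (q n && negb (p n)) (f n)) M).
Proof.
  intros H. rewrite <- vsum_add. apply vsum_ext. intros n Hn. specialize (H n Hn). unfold vsel.
  destruct (p n); [rewrite H by auto; simpl; now rewrite vadd_0_r|].
  destruct (q n); simpl; now rewrite vadd_0.
Qed.

Lemma vsum_trunc (p : nat -> bool) (f : nat -> X) M M' : (M <= M')%nat ->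
  vsum (fun n => vsel (p n) (f n)) M = vsum (fun n => vsel (p n && Nat.ltb n M) (f n)) M'.
Proof.
  intros H. induction H as [|M' H IH]; simpl.
  - apply vsum_ext. intros n Hn. apply Nat.ltb_lt in Hn. rewrite Hn. now rewrite Bool.andb_true_r.
  - rewrite IH. assert (E : Nat.ltb M' M = false) by (apply Nat.ltb_ge; auto).
    rewrite E, Bool.andb_false_r. simpl. now rewrite vadd_0_r.
Qed.

Lemma lsum_vsum (F : list nat) (f : nat -> X) M :
  NoDup F -> (forall n, In n F -> (n < M)%nat) ->
  lsum F f = vsum (fun n => vsel (if in_dec Nat.eq_dec n F then true else false) (f n)) M.
Proof.
  intros HN. induction HN as [|a F Ha HN IH]; intros HF.
  - symmetry. apply vsum_zero. intros n Hn. now destruct (in_dec Nat.eq_dec n []).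
  - simpl lsum. rewrite IH by (intros; apply HF; now right).
    assert (E : f a = vsum (fun n => vsel (Nat.eqb a n) (f n)) M).
    { assert (L : (a < M)%nat) by (apply HF; now left). clear -L.
      induction M as [|M IHM]; [lia|]. simpl.
      destruct (Nat.eqb_spec a M) as [->|N].
      - rewrite vsum_zero; [now rewrite vadd_0|]. intros n Hn.
        destruct (Nat.eqb_spec M n); [lia|reflexivity].
      - rewrite <- IHM by lia. cbn [vsel]. now rewrite vadd_0_r. }
    rewrite E at 1. rewrite <- vsum_add. apply vsum_ext. intros n Hn. unfold vsel.
    destruct (Nat.eqb_spec a n) as [->|N].
    + destruct (in_dec Nat.eq_dec n F); [contradiction|].
      destruct (in_dec Nat.eq_dec n (n :: F)) as [|C]; [now rewrite vadd_0_r|].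
      destruct C; now left.
    + rewrite vadd_0.
      destruct (in_dec Nat.eq_dec n F), (in_dec Nat.eq_dec n (a :: F)) as [K|K]; auto.
      * destruct K; now right.
      * now destruct K.
Qed.

End FiniteSums.

(** A total choice of inverse, meaningful on bijections. It avoids carrying a second family of maps;
    [inverse_eq_inv] matches it with any given inverse. *)
Definition inv {X : NormedSpace} (g : X -> X) : X -> X :=
  epsilon (inhabits (fun x => x)) (fun h => is_inverse g h).

Lemma inverse_unique {T : Type} (g h h' : T -> T) : is_inverse g h -> is_inverse g h' -> h = h'.
Proof.
  intros [H1 H2] [K1 K2]. apply functional_extensionality. intros x.
  rewrite <- (K1 x) at 1. now rewrite H2.
Qed.

(** Dislocations given along a subsequence only are completed by a default value, since
    [profile_along] expects a family over all indices. The new values stay among the old ones and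
    [t0]. *)
Lemma extend_along {T : Type} (s : nat -> nat) (gam : nat -> T) (t0 : T) : strictly_incr s ->
  exists gam', (forall j, gam' (s j) = gam j) /\ forall i, gam' i = t0 \/ exists j, gam' i = gam j.
Proof.
  intros Hs.
  destruct (choice (fun i t => (forall j, i = s j -> t = gam j) /\ (t = t0 \/ exists j, t = gam j))) as [f Hf].
  { intros i. destruct (classic (exists j, i = s j)) as [[j ->]|N].
    - exists (gam j). split; [|eauto]. intros j' E. now rewrite (strictly_incr_inj _ Hs _ _ E).
    - exists t0. split; auto. intros j E. destruct N; eauto. }
  exists f. split.
  - intros j. now apply Hf.
  - intros i. apply Hf.
Qed.

Section Dislocations.
Context {X : NormedSpace} (HB : Banach X) (HUC : uniformly_convex X).
Context (D0 D : (X -> X) -> Prop) (HD0 : dislocation_group D0).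
Context (HDsub : forall g, D g -> D0 g) (HDid : D (fun x => x)).

Lemma D0_inverse g : D0 g -> is_inverse g (inv g).
Proof.
  intros Hg. unfold inv. apply epsilon_spec.
  destruct HD0 as [[H _] _]. now destruct (H g Hg) as (_ & K & _).
Qed.

Lemma D0_inv g : D0 g -> D0 (inv g).
Proof.
  intros Hg. destruct HD0 as [(_ & _ & _ & H) _]. apply (H g); auto. now apply D0_inverse.
Qed.

Lemma D0_comp g h : D0 g -> D0 h -> D0 (fun x => g (h x)).
Proof. destruct HD0 as [(_ & _ & H & _) _]. auto. Qed.

Lemma D0_linear g : D0 g -> is_linear g.
Proof. intros Hg. destruct HD0 as [[H _] _]. apply (H g Hg). Qed.

Lemma D0_norm g x : D0 g -> vnorm (g x) = vnorm x.
Proof. intros Hg. destruct HD0 as [[H _] _]. apply (H g Hg). Qed.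

Lemma inv_l g x : D0 g -> inv g (g x) = x.
Proof. intros Hg. apply (D0_inverse g Hg). Qed.

Lemma inv_r g x : D0 g -> g (inv g x) = x.
Proof. intros Hg. apply (D0_inverse g Hg). Qed.

Lemma inverse_eq_inv g h : D0 g -> is_inverse g h -> h = inv g.
Proof. intros Hg H. apply (inverse_unique g); auto. now apply D0_inverse. Qed.

(** By isometry, adding y to [gam k (x k)] amounts to adding [eta k y] to [x k]. Along [phi] the
    vector [eta k y] is nearly constant, so Delta-nullity passes to the moved sequence, and
    uniqueness of the limit concludes. *)
Lemma dislocation_strong_limit (gam eta : nat -> X -> X) (x : nat -> X) w phi :
  (forall k, D0 (gam k)) -> (forall k, is_inverse (gam k) (eta k)) ->
  bounded_seq x -> delta_cv x vzero -> delta_cv (fun k => gam k (x k)) w ->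
  strictly_incr phi -> (forall z, exists l, norm_cv (fun j => eta (phi j) z) l) -> w = vzero.
Proof.
  intros Hg Hi [C HC] Hx Hw Hp Hl. symmetry.
  apply (delta_limit_unique HUC (fun j => gam (phi j) (x (phi j)))).
  - exists C. intros k. now rewrite D0_norm.
  - apply delta_cv0_ev. intros y eps He. destruct (Hl y) as [l Hly].
    assert (A := proj1 (delta_cv0_ev _) Hx l (eps / 2) ltac:(lra)).
    apply (ev_sub1 _ _ Hp) in A.
    apply (ev_imp2 _ _ _ A (proj1 (norm_cv_ev _ _) Hly (eps / 2) ltac:(lra))). intros k K1 K2.
    rewrite D0_norm by auto.
    replace (vadd (gam (phi k) (x (phi k))) y)
      with (gam (phi k) (vadd (x (phi k)) (eta (phi k) y)))
      by (rewrite (proj1 (D0_linear _ (Hg (phi k)))); now rewrite (proj1 (Hi (phi k)))).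
    rewrite D0_norm by auto.
    pose proof (vnorm_diff (vadd (x (phi k)) l) (vadd (x (phi k)) (eta (phi k) y)) (vsub (eta (phi k) y) l) ltac:(vlin)).
    lra.
  - exact (delta_cv_sub1 (fun k => gam k (x k)) w phi Hp Hw).
Qed.

(** If either composite failed to be weakly null, (star) would make [inv (g' k) (g k z)] converge
    strongly along a subsequence, and [dislocation_strong_limit] would force [w] to vanish. Since
    (star) covers a family together with its inverses, both claims follow. *)
Lemma ptw_weak0_of_profile (g g' : nat -> X -> X) (x : nat -> X) w :
  (forall k, D0 (g k)) -> (forall k, D0 (g' k)) -> bounded_seq x -> w <> vzero ->
  delta_cv (fun k => inv (g k) (x k)) w -> delta_cv (fun k => inv (g' k) (x k)) vzero ->
  ptw_weak0 (fun k z => inv (g k) (g' k z)) /\ ptw_weak0 (fun k z => inv (g' k) (g k z)).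
Proof.
  intros Hg Hg' [C HC] Hw Hx Hx'.
  assert (Hgam : forall k, D0 (fun z => inv (g k) (g' k z))).
  { intros k. apply (D0_comp (inv (g k)) (g' k)); auto. now apply D0_inv. }
  assert (Heta : forall k, D0 (fun z => inv (g' k) (g k z))).
  { intros k. apply (D0_comp (inv (g' k)) (g k)); auto. now apply D0_inv. }
  assert (I1 : forall k, is_inverse (fun z => inv (g k) (g' k z)) (fun z => inv (g' k) (g k z))).
  { intros k; split; intros z; now rewrite ?inv_r, ?inv_l by auto. }
  assert (I2 : forall k, is_inverse (fun z => inv (g' k) (g k z)) (fun z => inv (g k) (g' k z))).
  { intros k; destruct (I1 k); split; auto. }
  assert (K : forall phi, strictly_incr phi ->
     (forall z, exists l, norm_cv (fun j => inv (g' (phi j)) (g (phi j) z)) l) -> False).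
  { intros phi Hp Hl. apply Hw.
    apply (dislocation_strong_limit (fun k z => inv (g k) (g' k z)) (fun k z => inv (g' k) (g k z))
             (fun k => inv (g' k) (x k)) w phi); auto.
    - exists C. intros k. rewrite D0_norm; auto. now apply D0_inv.
    - apply (delta_cv_ev_eq (fun k => inv (g k) (x k))); auto.
      apply ev_all. intros k. now rewrite inv_r. }
  destruct HD0 as (_ & Hstar & _).
  split; apply NNPP; intros N.
  - destruct (Hstar _ _ Hgam I1 N) as (phi & Hp & _ & Hl). eapply K; eauto.
  - destruct (Hstar _ _ Heta I2 N) as (phi & Hp & Hl & _). eapply K; eauto.
Qed.

Lemma dislocation_add (u : nat -> X) w (g : nat -> X -> X) :
  delta_cv u vzero -> (forall k, D0 (g k)) -> ptw_weak0 g ->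
  delta_cv (fun k => vadd (u k) (g k w)) vzero.
Proof. destruct HD0 as (_ & _ & H). apply H. Qed.

(** Dislocations are indexed by the original index, so one family serves every further
    subsequence. *)
Definition profile_along (r : nat -> X) (s : nat -> nat) (v : X) : Prop :=
  exists gam, (forall k, D (gam k)) /\ delta_cv (fun j => inv (gam (s j)) (r (s j))) v.

Lemma profile_step (r : nat -> X) phi : bounded_seq r -> strictly_incr phi ->
  exists psi w (g : nat -> X -> X), sub psi phi /\ (forall k, D (g k)) /\
    delta_cv (fun j => inv (g (psi j)) (r (psi j))) w /\
    (exists a, Un_cv (fun j => vnorm (r (psi j))) a) /\
    (forall s v, sub s phi -> profile_along r s v -> vnorm v <= 2 * vnorm w).
Proof.
  intros [C HC] Hp.
  set (S := fun t => exists s v, sub s phi /\ profile_along r s v /\ t = vnorm v).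
  destruct (completeness S) as [m [Hm1 Hm2]].
  { exists (2 * C). intros t (s & v & Hs & (gam & Hg & Hv) & ->).
    apply (delta_limit_bound _ _ _ Hv). apply ev_all. intros k. rewrite D0_norm; auto. now apply D0_inv, HDsub. }
  { destruct (delta_compact HB HUC (fun j => inv (fun x => x) (r (phi j)))) as (s & l & Hs & Hl).
    { exists C. intros k. rewrite D0_norm; auto. now apply D0_inv, HDsub. }
    exists (vnorm l), (fun j => phi (s j)), l. split; [now apply sub_comp|]. split; auto.
    exists (fun _ x => x). split; auto. }
  (* If no profile reached half the supremum, then m would be at most m / 2, hence nonpositive, and
     any profile at all would do; one exists by compactness. *)
  assert (K : exists s v, sub s phi /\ profile_along r s v /\ m <= 2 * vnorm v).
  { apply NNPP. intros N.
    assert (L : m <= m / 2).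
    { apply Hm2. intros t (s & v & Hs & Hv & ->). apply Rnot_lt_le. intros L. apply N.
      exists s, v. repeat split; try apply Hs; auto. lra. }
    apply N. destruct (delta_compact HB HUC (fun j => inv (fun x => x) (r (phi j)))) as (s & l & Hs & Hl).
    { exists C. intros k. rewrite D0_norm; auto. now apply D0_inv, HDsub. }
    exists (fun j => phi (s j)), l. split; [now apply sub_comp|]. split.
    - exists (fun _ x => x). split; auto.
    - pose proof (vnorm_nonneg l). lra. }
  destruct K as (s & w & Hs & (g & Hg & Hw) & Hm).
  destruct (bounded_real_subseq (fun j => vnorm (r (s j))) C) as (t & a & Ht & Ha).
  { intros k. rewrite Rabs_right; [apply HC|]. apply Rle_ge, vnorm_nonneg. }
  exists (fun j => s (t j)), w, g. repeat split; auto.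
  - apply (strictly_incr_comp s t); auto. apply Hs.
  - apply (sub_trans _ s); auto. apply sub_comp; auto. apply Hs.
  - exact (delta_cv_sub1 (fun j => inv (g (s j)) (r (s j))) w t Ht Hw).
  - exists a. exact Ha.
  - intros s' v Hs' Hv. apply (Rle_trans _ m); auto. apply Hm1. exists s', v. auto.
Qed.

(** All stages are re-indexed along one diagonal sequence. Maximality is claimed from profile 1 on,
    because profile 0 uses the identity. *)
Lemma profiles_exist (u : nat -> X) : bounded_seq u ->
  exists phi (r : nat -> nat -> X) (w : nat -> X) (g : nat -> nat -> X -> X) (a : nat -> R),
    strictly_incr phi /\
    (forall k, r O k = u (phi k)) /\
    (forall n k, r (S n) k = vsub (r n k) (g n k (w n))) /\
    (forall n k, D (g n k)) /\
    (forall k x, g O k x = x) /\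
    (forall n, bounded_seq (r n)) /\
    (forall n, delta_cv (fun k => inv (g n k) (r n k)) (w n)) /\
    (forall n, Un_cv (fun k => vnorm (r n k)) (a n)) /\
    (forall n s gam v, strictly_incr s -> (forall k, D (gam k)) ->
       delta_cv (fun k => inv (gam k) (r (S n) (s k))) v -> vnorm v <= 2 * vnorm (w (S n))).
Proof.
  intros [C HC].
  destruct (delta_compact HB HUC (fun j => inv (fun x => x) (u j))) as (s0 & w0 & Hs0 & Hw0).
  { exists C. intros k. rewrite D0_norm; auto. now apply D0_inv, HDsub. }
  destruct (bounded_real_subseq (fun j => vnorm (u (s0 j))) C) as (t0 & a0 & Ht0 & Ha0).
  { intros k. rewrite Rabs_right; [apply HC|]. apply Rle_ge, vnorm_nonneg. }
  set (state := ((nat -> nat) * (nat -> X) * X * (nat -> X -> X))%type).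
  set (ph := fun a : state => fst (fst (fst a))).
  set (re := fun a : state => snd (fst (fst a))).
  set (pr := fun a : state => snd (fst a)).
  set (ge := fun a : state => snd a).
  destruct (dependent_choice (A := state)
    (fun a => strictly_incr (ph a) /\ bounded_seq (re a) /\ (forall k, D (ge a k)) /\
       delta_cv (fun j => inv (ge a (ph a j)) (re a (ph a j))) (pr a) /\
       exists l, Un_cv (fun j => vnorm (re a (ph a j))) l)
    (fun n a b => sub (ph b) (ph a) /\ (forall k, re b k = vsub (re a k) (ge a k (pr a))) /\
       forall s v, sub s (ph a) -> profile_along (re b) s v -> vnorm v <= 2 * vnorm (pr b))
    (fun j => s0 (t0 j), u, w0, fun _ x => x)) as [f [Hf0 Hf]].
  { unfold ph, re, pr, ge; cbn [fst snd]. repeat split.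
    - now apply strictly_incr_comp.
    - now exists C.
    - intros _; exact HDid.
    - exact (delta_cv_sub1 (fun j => inv (fun x => x) (u (s0 j))) w0 t0 Ht0 Hw0).
    - now exists a0. }
  { intros n [[[pa ra] wa] ga]. unfold ph, re, pr, ge; cbn [fst snd]. intros (Hp & [B HBd] & HD & Hd & _).
    assert (Hb : bounded_seq (fun k => vsub (ra k) (ga k wa))).
    { exists (B + vnorm wa). intros k. specialize (HBd k).
      pose proof (vnorm_diff _ (ra k) (ga k wa) eq_refl) as K.
      rewrite (D0_norm (ga k)) in K by auto. lra. }
    destruct (profile_step (fun k => vsub (ra k) (ga k wa)) pa) as (psi & w & g & H1 & H2 & H3 & H4 & H5); auto.
    exists (psi, (fun k => vsub (ra k) (ga k wa)), w, g). cbn [fst snd].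
    repeat split; auto; apply H1. }
  destruct (diagonal (fun n => ph (f n))) as [d [Hd Hds]]; [apply Hf|apply Hf|].
  assert (Hph : forall n, strictly_incr (ph (f n))) by apply Hf.
  destruct (choice (fun n l => Un_cv (fun j => vnorm (re (f n) (ph (f n) j))) l)) as [a Ha].
  { intros n. apply Hf. }
  exists d, (fun n k => re (f n) (d k)), (fun n => pr (f n)), (fun n k => ge (f n) (d k)), a.
  repeat split; auto.
  - intros k. now rewrite Hf0.
  - intros n k. apply (Hf n).
  - intros n k. apply (Hf n).
  - intros k x. now rewrite Hf0.
  - intros n. destruct (Hf n) as [(_ & [B HBd] & _) _]. exists B. intros k. apply HBd.
  - intros n. destruct (Hf n) as [(_ & _ & _ & H & _) _].
    apply delta_cv_ev. intros y eps He.
    apply (sub_shift_ev (fun i => vnorm (vsub (inv (ge (f n) i) (re (f n) i)) (pr (f n))) <=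
       vnorm (vsub (inv (ge (f n) i) (re (f n) i)) y) + eps) d n).
    apply (ev_sub (fun i => vnorm (vsub (inv (ge (f n) i) (re (f n) i)) (pr (f n))) <=
       vnorm (vsub (inv (ge (f n) i) (re (f n) i)) y) + eps) (ph (f n))); auto.
    now apply delta_cv_ev.
  - intros n. apply Un_cv_ev. intros eps He.
    apply (sub_shift_ev (fun i => Rabs (vnorm (re (f n) i) - a n) < eps) d n).
    apply (ev_sub (fun i => Rabs (vnorm (re (f n) i) - a n) < eps) (ph (f n))); auto.
    exact (proj1 (Un_cv_ev _ _) (Ha n) eps He).
  - intros n s gam v Hs HD Hv.
    (* Without its first n terms, [s] has all values at least n, where [d] takes its values in stage
       n; dropping them leaves the Delta-limit unchanged. *)
    assert (Hdsn : strictly_incr (fun j => s (j + n)%nat)) by (intros j; apply (Hs (j + n)%nat)).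
    destruct (extend_along (fun j => d (s (j + n)%nat)) (fun j => gam (j + n)%nat) (fun x => x)) as [gam' [G1 G2]].
    { now apply (strictly_incr_comp d (fun j => s (j + n)%nat)). }
    destruct (Hf n) as (_ & _ & _ & Hmax). apply (Hmax (fun j => d (s (j + n)%nat)) v).
    + split; [now apply (strictly_incr_comp d (fun j => s (j + n)%nat))|].
      intros j. destruct (proj2 (Hds n) (s (j + n) - n)%nat) as [i Hi]. exists i. rewrite <- Hi. f_equal.
      pose proof (strictly_incr_ge _ Hs (j + n)). lia.
    + exists gam'. split.
      * intros k. destruct (G2 k) as [->|[j ->]]; auto.
      * apply (delta_cv_ev_eq (fun j => inv (gam (j + n)%nat) (re (f (S n)) (d (s (j + n)%nat))))).
        -- apply ev_all. intros k. now rewrite G1.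
        -- apply (delta_cv_sub1 (fun k => inv (gam k) (re (f (S n)) (d (s k)))) v (fun j => (j + n)%nat)); auto.
           intros j; lia.
Qed.

End Dislocations.

(** * Orthogonality and energy *)

Lemma Un_cv_le (x y : nat -> R) a b c :
  Un_cv x a -> Un_cv y b -> ev (fun k => x k <= y k + c) -> a <= b + c.
Proof.
  rewrite !Un_cv_ev. intros Hx Hy H. apply Rnot_lt_le. intros L.
  set (e := (a - (b + c)) / 2). assert (He : e > 0) by (unfold e; lra).
  destruct (ev_ex _ (ev_and _ _ H (ev_and _ _ (Hx e He) (Hy e He)))) as (k & K1 & K2 & K3).
  apply Rabs_def2 in K2. apply Rabs_def2 in K3. unfold e in *. lra.
Qed.

Lemma Un_cv_const c : Un_cv (fun _ => c) c.
Proof. apply Un_cv_ev. intros eps He. apply ev_all. intros _. rewrite Rminus_diag, Rabs_R0. lra. Qed.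

Lemma Un_cv_le_const (x : nat -> R) a c : Un_cv x a -> ev (fun k => x k <= c) -> a <= c.
Proof.
  intros Hx H. rewrite <- (Rplus_0_r c).
  apply (Un_cv_le x (fun _ => c)); auto; [apply Un_cv_const|].
  apply (ev_imp _ _ H). intros; lra.
Qed.

Lemma Un_cv_ge_const (x : nat -> R) a c : Un_cv x a -> ev (fun k => c <= x k) -> c <= a.
Proof.
  intros Hx H. rewrite <- (Rplus_0_r a).
  apply (Un_cv_le (fun _ => c) x); auto; [apply Un_cv_const|].
  apply (ev_imp _ _ H). intros; lra.
Qed.

(** Only the first [M] values of a selection matter, so this is a conjunction of finitely many
    eventual properties. The induction fixes the value at the last index both ways. *)
Lemma ev_forall_selection M (Q : (nat -> bool) -> nat -> Prop) :
  (forall p p' k, (forall n, (n < M)%nat -> p n = p' n) -> Q p k -> Q p' k) ->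
  (forall p, ev (Q p)) -> ev (fun k => forall p, Q p k).
Proof.
  revert Q. induction M as [|M IH]; intros Q HQ H.
  - apply (ev_imp _ _ (H (fun _ => true))). intros k Hk p.
    apply (HQ (fun _ => true)); auto. intros; lia.
  - set (upd := fun (p : nat -> bool) b n => if Nat.eqb n M then b else p n).
    assert (E : ev (fun k => forall p, Q (upd p true) k /\ Q (upd p false) k)).
    { apply (IH (fun p k => Q (upd p true) k /\ Q (upd p false) k)).
      - assert (U : forall p p' b n, (forall i, (i < M)%nat -> p i = p' i) -> (n < S M)%nat -> upd p b n = upd p' b n).
        { intros p p' b n Hp Hn. unfold upd. destruct (Nat.eqb_spec n M); auto. apply Hp. lia. }
        intros p p' k Hp [K1 K2]. split.
        + apply (HQ (upd p true)); auto.
        + apply (HQ (upd p false)); auto.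
      - intros p. apply ev_and; auto. }
    apply (ev_imp _ _ E). intros k K p. destruct (K p) as [K1 K2].
    assert (U : forall b, p M = b -> forall n, upd p b n = p n).
    { intros b Hb n. unfold upd. destruct (Nat.eqb_spec n M); congruence. }
    destruct (p M) eqn:Ep.
    + apply (HQ (upd p true)); auto.
    + apply (HQ (upd p false)); auto.
Qed.

Lemma lsumR_app (l l' : list nat) f : lsumR (l ++ l') f = lsumR l f + lsumR l' f.
Proof. induction l as [|a l IH]; simpl; [|rewrite IH]; ring. Qed.

Lemma lsumR_incl (F L : list nat) f : NoDup F -> incl F L -> (forall n, 0 <= f n) -> lsumR F f <= lsumR L f.
Proof.
  intros HN. revert L. induction HN as [|a F Ha HN IH]; intros L HI Hf.
  - simpl. clear HI. induction L as [|b L IHL]; simpl; [lra|]. specialize (Hf b). lra.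
  - destruct (in_split a L) as (l1 & l2 & ->); [apply HI; now left|].
    rewrite lsumR_app. simpl.
    assert (K : lsumR F f <= lsumR (l1 ++ l2) f).
    { apply IH; auto. intros b Hb. assert (Hb' := HI b (or_intror Hb)).
      apply in_app_or in Hb'. apply in_or_app. destruct Hb' as [|[->|]]; tauto. }
    rewrite lsumR_app in K. lra.
Qed.

(** The bound 2 provides the pair x/2, -x/2, so that the set defining the modulus is nonempty and
    the chosen value is its infimum. *)
Lemma modconv_nonneg {X : NormedSpace} (x : X) : vnorm x <= 2 -> 0 <= modconv X (vnorm x).
Proof.
  intros Hx.
  destruct (epsilon_spec (inhabits 0) (fun d => is_glb (modconv_set X (vnorm x)) d)) as [_ K].
  - apply (glb_exists _ 0).
    + exists (1 - vnorm (mid (vscal (1/2) x) (vscal (-1/2) x))), (vscal (1/2) x), (vscal (-1/2) x).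
      rewrite vnorm_scal_pos by lra.
      replace (vscal (-1/2) x) with (vopp (vscal (1/2) x)) by vlin.
      rewrite vnorm_opp, vnorm_scal_pos by lra.
      repeat split; try lra. right. f_equal. vlin.
    + intros s (a & b & Ha & Hb & _ & ->). rewrite vnorm_scal_pos by lra.
      pose proof (vnorm_triangle X a b). lra.
  - apply K. intros s (a & b & Ha & Hb & _ & ->). rewrite vnorm_scal_pos by lra.
    pose proof (vnorm_triangle X a b). lra.
Qed.

(* The profiles entering the decomposition: the first one, possibly zero, and the nonzero ones. *)
Definition active {X : NormedSpace} (w : nat -> X) (n : nat) : bool :=
  match n with
  | O => true
  | S _ => if excluded_middle_informative (w n = vzero) then false else true
  end.

Section ActiveProfiles.
Context {X : NormedSpace} (w : nat -> X).

Lemma inactive_zero n : active w n = false -> w n = vzero.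
Proof. destruct n; simpl; [discriminate|]. now destruct (excluded_middle_informative _). Qed.

Lemma active_nonzero n m : (m < n)%nat -> active w n = true -> w n <> vzero.
Proof. destruct n; simpl; [lia|]. now destruct (excluded_middle_informative _). Qed.

End ActiveProfiles.

Section Profiles.
Context {X : NormedSpace} (HUC : uniformly_convex X).
Context (D0 : (X -> X) -> Prop) (HD0 : dislocation_group D0).
Context (r : nat -> nat -> X) (w : nat -> X) (g : nat -> nat -> X -> X) (a : nat -> R).
Context (HrS : forall n k, r (S n) k = vsub (r n k) (g n k (w n))).
Context (Hg : forall n k, D0 (g n k)).
Context (Hbd : forall n, bounded_seq (r n)).
Context (Hw : forall n, delta_cv (fun k => inv (g n k) (r n k)) (w n)).
Context (Ha : forall n, Un_cv (fun k => vnorm (r n k)) (a n)).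

Let Hgi n k : D0 (inv (g n k)).
Proof. apply (D0_inv D0 HD0), Hg. Qed.

Let inv_g n k x : inv (g n k) (g n k x) = x.
Proof. apply (inv_l D0 HD0), Hg. Qed.

Lemma inactive_term n k : active w n = false -> g n k (w n) = vzero.
Proof. intros H. rewrite inactive_zero by auto. apply linear_zero, (D0_linear D0 HD0), Hg. Qed.

Lemma remainder_norm n k : vnorm (r (S n) k) = vnorm (vsub (inv (g n k) (r n k)) (w n)).
Proof.
  rewrite HrS. rewrite <- (D0_norm D0 HD0 (inv (g n k)) _ (Hgi n k)).
  rewrite linear_sub by apply (D0_linear D0 HD0), Hgi. now rewrite inv_g.
Qed.

Lemma remainder_norm_le n y eps : eps > 0 ->
  ev (fun k => vnorm (r (S n) k) <= vnorm (vsub (r n k) (g n k y)) + eps).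
Proof.
  intros He. apply (ev_imp _ _ (proj1 (delta_cv_ev _ _) (Hw n) y eps He)). intros k Hk.
  rewrite remainder_norm. rewrite <- (D0_norm D0 HD0 (inv (g n k)) (vsub (r n k) (g n k y)) (Hgi n k)).
  rewrite linear_sub by apply (D0_linear D0 HD0), Hgi. rewrite inv_g. exact Hk.
Qed.

(** The two halves feed each other, hence a joint induction: nullity along [g m] gives orthogonality
    to the next dislocation, which preserves nullity when the next profile is removed. An inactive
    profile changes nothing. *)
Lemma profiles_orthogonal N :
  (forall m, (m < N)%nat -> active w m = true -> delta_cv (fun k => inv (g m k) (r N k)) vzero) /\
  (forall m n, (m < N)%nat -> (n < N)%nat -> m <> n -> active w m = true -> active w n = true ->
     ptw_weak0 (fun k x => inv (g m k) (g n k x))).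
Proof.
  induction N as [|N [IH1 IH2]]; [split; intros; lia|].
  assert (P : active w N = true -> forall m, (m < N)%nat -> active w m = true ->
     ptw_weak0 (fun k z => inv (g N k) (g m k z)) /\ ptw_weak0 (fun k z => inv (g m k) (g N k z))).
  { intros HN m Hm Am.
    apply (ptw_weak0_of_profile HUC D0 HD0 (g N) (g m) (r N) (w N)); auto.
    now apply (active_nonzero w N m). }
  split.
  - intros m Hm Am.
    destruct (Nat.eq_dec m N) as [->|Hne].
    + apply (delta_cv_ev_eq (fun k => vsub (inv (g N k) (r N k)) (w N))).
      * apply ev_all. intros k. rewrite HrS, linear_sub by apply (D0_linear D0 HD0), Hgi.
        now rewrite inv_g.
      * now apply delta_cv_shift.
    + assert (Hm' : (m < N)%nat) by lia. specialize (IH1 m Hm' Am).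
      destruct (active w N) eqn:AN.
      * apply (delta_cv_ev_eq (fun k => vadd (inv (g m k) (r N k)) (inv (g m k) (g N k (vopp (w N)))))).
        -- apply ev_all. intros k. rewrite HrS, linear_sub by apply (D0_linear D0 HD0), Hgi.
           unfold vsub. f_equal. rewrite !vopp_scal.
           rewrite (proj2 (D0_linear D0 HD0 _ (Hg N k))), (proj2 (D0_linear D0 HD0 _ (Hgi m k))). reflexivity.
        -- apply (dislocation_add D0 HD0 _ (vopp (w N)) (fun k z => inv (g m k) (g N k z))); auto.
           ++ intros k. apply (D0_comp D0 HD0 (inv (g m k)) (g N k)); auto.
           ++ now apply P.
      * apply (delta_cv_ev_eq (fun k => inv (g m k) (r N k))); auto.
        apply ev_all. intros k. rewrite HrS, inactive_term by auto. now rewrite vsub_0_r.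
  - intros m n Hm Hn Hmn Am An.
    destruct (Nat.eq_dec m N) as [->|]; [apply P; auto; lia|].
    destruct (Nat.eq_dec n N) as [->|]; [apply P; auto; lia|].
    apply IH2; auto; lia.
Qed.

(** Orthogonality lets (star star) absorb the terms one by one. The vectors [v] are arbitrary, so
    that halved profiles are covered as well. *)
Lemma add_profiles_null (q : nat -> bool) (v : nat -> X) (x : nat -> X) M m :
  active w m = true -> (forall n, (n < M)%nat -> q n = true -> active w n = true /\ n <> m) ->
  delta_cv (fun k => inv (g m k) (x k)) vzero ->
  delta_cv (fun k => inv (g m k) (vadd (x k) (vsum (fun n => vsel (q n) (g n k (v n))) M))) vzero.
Proof.
  intros Am. induction M as [|M IH]; intros Hq Hx.
  - apply (delta_cv_ev_eq (fun k => inv (g m k) (x k))); auto.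
    apply ev_all. intros k. simpl. now rewrite vadd_0_r.
  - assert (IH' := IH (fun n Hn => Hq n (Nat.lt_lt_succ_r _ _ Hn)) Hx). clear IH.
    destruct (q M) eqn:EM.
    + destruct (Hq M (Nat.lt_succ_diag_r M) EM) as [AM NM].
      apply (delta_cv_ev_eq (fun k => vadd (inv (g m k) (vadd (x k) (vsum (fun n => vsel (q n) (g n k (v n))) M)))
        (inv (g m k) (g M k (v M))))).
      * apply ev_all. intros k. rewrite <- (proj1 (D0_linear D0 HD0 _ (Hgi m k))).
        f_equal. simpl. rewrite EM. simpl. now rewrite vadd_assoc.
      * apply (dislocation_add D0 HD0 _ (v M) (fun k z => inv (g m k) (g M k z))); auto.
        -- intros k. apply (D0_comp D0 HD0 (inv (g m k)) (g M k)); auto.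
        -- apply (proj2 (profiles_orthogonal (S (max m M)))); auto; lia.
    + apply (delta_cv_ev_eq (fun k => inv (g m k) (vadd (x k) (vsum (fun n => vsel (q n) (g n k (v n))) M)))); auto.
      apply ev_all. intros k. f_equal. simpl. rewrite EM. simpl. now rewrite vadd_0_r.
Qed.

(** After some terms have been added, the sequence is still null along the next dislocation by
    [add_profiles_null], so the next term cannot shorten it; the errors are halved at each stage. *)
Lemma add_profiles_norm (q : nat -> bool) (v : nat -> X) (x : nat -> X) M :
  (forall n, (n < M)%nat -> q n = true -> active w n = true /\ delta_cv (fun k => inv (g n k) (x k)) vzero) ->
  forall eps, eps > 0 ->
  ev (fun k => vnorm (x k) <= vnorm (vadd (x k) (vsum (fun n => vsel (q n) (g n k (v n))) M)) + eps).
Proof.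
  induction M as [|M IH]; intros Hq eps He.
  - apply ev_all. intros k. simpl. rewrite vadd_0_r. lra.
  - assert (IH' := IH (fun n Hn => Hq n (Nat.lt_lt_succ_r _ _ Hn)) (eps / 2) ltac:(lra)). clear IH.
    destruct (q M) eqn:EM.
    + destruct (Hq M (Nat.lt_succ_diag_r M) EM) as [AM NM].
      assert (K := add_profiles_null q v x M M AM).
      assert (K' : forall n, (n < M)%nat -> q n = true -> active w n = true /\ n <> M).
      { intros n Hn Qn. split; [|lia]. apply Hq; auto. }
      specialize (K K' NM). rewrite delta_cv0_ev in K. specialize (K (v M) (eps / 2) ltac:(lra)).
      apply (ev_imp2 _ _ _ IH' K). intros k K1 K2. simpl. rewrite EM. simpl.
      set (x' := vadd (x k) (vsum (fun n => vsel (q n) (g n k (v n))) M)) in *.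
      rewrite (D0_norm D0 HD0) in K2 by auto.
      rewrite <- (inv_g M k (v M)), <- (proj1 (D0_linear D0 HD0 _ (Hgi M k))) in K2.
      rewrite (D0_norm D0 HD0) in K2 by auto.
      rewrite vadd_assoc. fold x'. lra.
    + apply (ev_imp _ _ IH'). intros k K. simpl. rewrite EM. simpl. rewrite vadd_0_r. lra.
Qed.

Lemma remainder_telescope N M k : (N <= M)%nat ->
  r N k = vadd (r M k) (vsum (fun n => vsel (Nat.leb N n) (g n k (w n))) M).
Proof.
  intros H. induction H as [|M H IH].
  - rewrite vsum_zero; [now rewrite vadd_0_r|]. intros n Hn.
    destruct (Nat.leb_spec N n); [lia|reflexivity].
  - simpl. rewrite IH, HrS. destruct (Nat.leb_spec N M); [|lia]. simpl. vlin.
Qed.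

(* The ends r N and r N - V, where V is the sum over p, have norm at most about a N, close to inf a, while the norm of
   their midpoint is asymptotically at least that of r M, hence at least inf a; so V is small by uniform convexity. *)
Lemma profile_sums_small eps : eps > 0 ->
  exists N, forall (p : nat -> bool) M, (forall n, p n = true -> (N <= n)%nat) ->
    ev (fun k => vnorm (vsum (fun n => vsel (p n) (g n k (w n))) M) < eps).
Proof.
  intros He.
  destruct (glb_exists (fun t => exists n, t = a n) 0) as [A HA].
  { exists (a O); eauto. }
  { intros s [n ->]. apply (Un_cv_ge_const _ _ _ (Ha n)). apply ev_all. intros; apply vnorm_nonneg. }
  assert (HAn : forall n, A <= a n) by (intros n; apply HA; eauto).
  assert (HA0 : 0 <= A).
  { apply HA. intros s [n ->]. apply (Un_cv_ge_const _ _ _ (Ha n)). apply ev_all. intros; apply vnorm_nonneg. }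
  destruct (midpoint_gap HUC (A + 1) eps) as (d & Hd & G); [lra|auto|].
  (* Six errors of size [e] accumulate in the final comparison, so [d / 10] leaves room. *)
  set (e := Rmin (d / 10) (1 / 10)).
  assert (He0 : e > 0) by (apply Rmin_glb_lt; lra).
  assert (He1 : e <= 1 / 10) by apply Rmin_r.
  assert (Hed : e <= d / 10) by apply Rmin_l.
  destruct (glb_approx _ _ _ HA He0) as (s & [N ->] & HN).
  exists N. intros p M Hp.
  destruct (Nat.lt_ge_cases M N) as [L|L].
  { apply ev_all. intros k. rewrite vsum_zero; [rewrite vnorm_zero; lra|].
    intros n Hn. destruct (p n) eqn:E; [apply Hp in E; lia|reflexivity]. }
  (* [V2] is the sum to be estimated and [V1] collects the remaining late profiles, so that [r N] is
     [r M] + [V1] + [V2]. Restricting to active indices drops only zero terms and makes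
     orthogonality available. *)
  set (q1 := fun n => (active w n && Nat.leb N n && negb (p n))%bool).
  set (q2 := fun n => (active w n && p n)%bool).
  set (V1 := fun k => vsum (fun n => vsel (q1 n) (g n k (w n))) M).
  set (V2 := fun k => vsum (fun n => vsel (q2 n) (g n k (w n))) M).
  assert (EV : forall k, vsum (fun n => vsel (p n) (g n k (w n))) M = V2 k).
  { intros k. apply vsum_ext. intros n Hn. unfold q2.
    destruct (active w n) eqn:An; [reflexivity|]. rewrite inactive_term by auto. now destruct (p n). }
  assert (EN : forall k, r N k = vadd (vadd (r M k) (V1 k)) (V2 k)).
  { intros k. rewrite (remainder_telescope N M k L), <- vadd_assoc. f_equal.
    unfold V1, V2. rewrite <- vsum_add. apply vsum_ext. intros n Hn. unfold q1, q2.
    destruct (active w n) eqn:An.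
    - destruct (p n) eqn:Pn.
      + apply Hp in Pn. destruct (Nat.leb_spec N n); [|lia]. simpl. now rewrite vadd_0.
      + destruct (Nat.leb N n); simpl; now rewrite vadd_0_r.
    - rewrite inactive_term by auto. simpl. destruct (Nat.leb N n); simpl; now rewrite vadd_0. }
  destruct (profiles_orthogonal M) as [Null _].
  assert (A1 : forall n, q1 n = true -> active w n = true /\ p n = false).
  { intros n. unfold q1. destruct (active w n), (p n), (Nat.leb N n); simpl; auto. }
  assert (A2 : forall n, q2 n = true -> active w n = true /\ p n = true).
  { intros n. unfold q2. destruct (active w n), (p n); simpl; auto. }
  assert (S1 : ev (fun k => vnorm (vadd (r M k) (V1 k)) <= vnorm (r N k) + e)).
  { apply (ev_imp _ _ (add_profiles_norm q2 w (fun k => vadd (r M k) (V1 k)) M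
      ltac:(intros n Hn Qn; destruct (A2 n Qn) as [An Pn]; split; [exact An|];
            apply add_profiles_null; auto; intros m Hm Qm; destruct (A1 m Qm); split; auto; congruence) e He0)).
    intros k Hk. cbv beta in Hk. fold (V2 k) in Hk. rewrite <- EN in Hk. exact Hk. }
  (* The midpoint of [r N] and [r M] + [V1] is [r M] + [V3] + [V1]; it is compared with [r M] by
     adding [V3] and [V1] in turn. *)
  set (V3 := fun k => vsum (fun n => vsel (q2 n) (g n k (vscal (1/2) (w n)))) M).
  assert (E3 : forall k, V3 k = vscal (1/2) (V2 k)).
  { intros k. unfold V3, V2. rewrite <- vsum_scal. apply vsum_ext. intros n Hn.
    destruct (q2 n); simpl; [apply (D0_linear D0 HD0), Hg|now rewrite vscal_0r]. }
  assert (S2 : ev (fun k => vnorm (r M k) <= vnorm (vadd (r M k) (V3 k)) + e)).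
  { apply (add_profiles_norm q2 (fun n => vscal (1/2) (w n)) (r M) M); auto.
    intros n Hn Qn. destruct (A2 n Qn). auto. }
  assert (S3 : ev (fun k => vnorm (vadd (r M k) (V3 k)) <= vnorm (vadd (vadd (r M k) (V3 k)) (V1 k)) + e)).
  { apply (add_profiles_norm q1 w (fun k => vadd (r M k) (V3 k)) M); auto.
    intros n Hn Qn. destruct (A1 n Qn) as [An Pn]. split; auto.
    apply (add_profiles_null q2 (fun n => vscal (1/2) (w n))); auto.
    intros m Hm Qm. destruct (A2 m Qm). split; auto. congruence. }
  assert (T := ev_and _ _ (proj1 (Un_cv_ev _ _) (Ha N) e He0) (proj1 (Un_cv_ev _ _) (Ha M) e He0)).
  apply (ev_imp3 _ _ _ _ (ev_and _ _ S1 S2) S3 T).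
  intros k [K1 K2] K3 [K4 K5]. apply Rabs_def2 in K4. apply Rabs_def2 in K5.
  specialize (HAn M). rewrite EV. apply Rnot_le_lt. intros LE.
  assert (Mid := G (vnorm (r N k) + e) (r N k) (vadd (r M k) (V1 k)) ltac:(lra) ltac:(lra) K1).
  rewrite (EN k) in *.
  replace (vsub (vadd (vadd (r M k) (V1 k)) (V2 k)) (vadd (r M k) (V1 k))) with (V2 k) in Mid by vlin.
  specialize (Mid LE).
  replace (mid (vadd (vadd (r M k) (V1 k)) (V2 k)) (vadd (r M k) (V1 k)))
    with (vadd (vadd (r M k) (V3 k)) (V1 k)) in Mid by (rewrite E3; unfold mid; vlin).
  lra.
Qed.

(** If the norm grew, the midpoint of the two remainders would be shorter than [r (S n) k] by [d],
    while the choice of the profile allows only [d / 2]. The absence of an error term keeps all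
    remainders eventually in the unit ball. *)
Lemma remainder_norm_decr n : w n <> vzero -> ev (fun k => vnorm (r (S n) k) <= vnorm (r n k)).
Proof.
  intros Hn. destruct (Hbd n) as [B HBn]. apply vnorm_pos in Hn.
  assert (HB0 : 0 <= B) by (eapply Rle_trans; [apply (vnorm_nonneg (r n O))|apply HBn]).
  destruct (midpoint_gap HUC (B + vnorm (w n)) (vnorm (w n))) as (d & Hd & G); [lra|auto|].
  apply (ev_imp _ _ (remainder_norm_le n (vscal (1/2) (w n)) (d / 2) ltac:(lra))). intros k Hk.
  apply Rnot_lt_le. intros L. specialize (HBn k).
  assert (Hdiff : vnorm (vsub (r n k) (r (S n) k)) = vnorm (w n)).
  { rewrite HrS. replace (vsub (r n k) (vsub (r n k) (g n k (w n)))) with (g n k (w n)) by vlin.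
    now apply (D0_norm D0 HD0). }
  assert (M := G (vnorm (r (S n) k)) (r n k) (r (S n) k)).
  rewrite Hdiff in M.
  replace (mid (r n k) (r (S n) k)) with (vsub (r n k) (g n k (vscal (1/2) (w n)))) in M.
  - assert (vnorm (r (S n) k) <= B + vnorm (w n)).
    { pose proof (vnorm_diff (r (S n) k) (r n k) (g n k (w n)) (HrS n k)) as T.
      rewrite (D0_norm D0 HD0 (g n k)) in T by auto. lra. }
    specialize (M ltac:(lra) ltac:(lra) ltac:(lra) ltac:(lra)). lra.
  - rewrite (proj2 (D0_linear D0 HD0 _ (Hg n k))), HrS. unfold mid. vlin.
Qed.

(** The midpoint of consecutive remainders is [r n k] minus half the moved profile, hence
    asymptotically no shorter than [r (S n) k]; [modconv_ball] bounds it from above. *)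
Lemma remainder_energy_step n : w n <> vzero -> ev (fun k => vnorm (r n k) <= 1) ->
  a (S n) + modconv X (vnorm (w n)) <= a n.
Proof.
  intros Hn H1. apply le_epsilon. intros eps He.
  assert (a (S n) <= a n + (eps - modconv X (vnorm (w n)))); [|lra].
  apply (Un_cv_le _ _ _ _ _ (Ha (S n)) (Ha n)).
  apply (ev_imp3 _ _ _ _ (remainder_norm_le n (vscal (1/2) (w n)) eps He) H1 (remainder_norm_decr n Hn)).
  intros k K1 K2 K3.
  assert (M := modconv_ball (r n k) (r (S n) k) (vnorm (w n)) (vnorm (r n k)) (vnorm_pos _ Hn) K2 (Rle_refl _) K3).
  replace (vsub (r n k) (r (S n) k)) with (g n k (w n)) in M by (rewrite HrS; vlin).
  rewrite (D0_norm D0 HD0 (g n k)) in M by auto. specialize (M (Rle_refl _)).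
  replace (mid (r n k) (r (S n) k)) with (vsub (r n k) (g n k (vscal (1/2) (w n)))) in M.
  - lra.
  - rewrite (proj2 (D0_linear D0 HD0 _ (Hg n k))), HrS. unfold mid. vlin.
Qed.

Lemma remainder_zero_step n : w n = vzero -> forall k, r (S n) k = r n k.
Proof.
  intros Hn k. rewrite HrS, Hn, linear_zero by apply (D0_linear D0 HD0), Hg. apply vsub_0_r.
Qed.

Section Energy.
Context (Hunit : forall k, vnorm (r O k) <= 1).

Lemma remainder_unit n : ev (fun k => vnorm (r n k) <= 1).
Proof.
  induction n as [|n IH]; [now apply ev_all|].
  destruct (classic (w n = vzero)) as [E|E].
  - apply (ev_imp _ _ IH). intros k. now rewrite remainder_zero_step.
  - apply (ev_imp2 _ _ _ IH (remainder_norm_decr n E)). intros; lra.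
Qed.

Lemma profile_norm_le_2 n : vnorm (w n) <= 2.
Proof.
  rewrite <- (Rmult_1_r 2). apply (delta_limit_bound _ _ _ (Hw n)).
  apply (ev_imp _ _ (remainder_unit n)). intros k. rewrite (D0_norm D0 HD0); auto.
Qed.

Lemma profile_energy n :
  a n + lsumR (seq 0 n) (fun m => if active w m then modconv X (vnorm (w m)) else 0) <= 1.
Proof.
  induction n as [|n IH].
  - simpl. rewrite Rplus_0_r. apply (Un_cv_le_const _ _ _ (Ha O)). apply (remainder_unit O).
  - rewrite seq_S, lsumR_app. cbn [lsumR fold_right plus].
    destruct (classic (w n = vzero)) as [E|E].
    + assert (Ea : a (S n) <= a n).
      { rewrite <- (Rplus_0_r (a n)). apply (Un_cv_le _ _ _ _ _ (Ha (S n)) (Ha n)).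
        apply ev_all. intros k. rewrite remainder_zero_step; auto. lra. }
      destruct (active w n) eqn:An; [|lra].
      (* Only profile 0 can be active and zero. Its term, the modulus at 0, is paid for by taking
         both points equal to [r 0 k]. *)
      destruct n as [|n]; [|now destruct (active_nonzero w (S n) O (Nat.lt_0_succ _) An)].
      assert (a O <= 1 - modconv X (vnorm (w O))).
      { apply (Un_cv_le_const _ _ _ (Ha O)). apply ev_all. intros k.
        assert (M := modconv_le (r O k) (r O k) (vnorm (w O)) (Hunit k) (Hunit k)).
        replace (mid (r O k) (r O k)) with (r O k) in M by (unfold mid; vlin).
        replace (vsub (r O k) (r O k)) with (vzero : X) in M by vlin.
        rewrite E in *. specialize (M (Rle_refl _)). lra. }
      simpl. lra.
    + assert (K := remainder_energy_step n E (remainder_unit n)).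
      destruct (active w n) eqn:An; [lra|]. now apply inactive_zero in An.
Qed.

End Energy.

End Profiles.

(** * Uniform convergence of the profile series *)

Lemma half_pow_small eps : eps > 0 -> exists i, 2 * (1/2) ^ i <= eps.
Proof.
  intros He. destruct (pow_lt_1_zero (1/2) ltac:(rewrite Rabs_right; lra) (eps / 2) ltac:(lra)) as [i Hi].
  exists i. specialize (Hi i (Nat.le_refl _)). apply Rabs_def2 in Hi. lra.
Qed.

Lemma vsum_support {X : NormedSpace} (p : nat -> bool) (f : nat -> X) M B :
  (forall n, p n = true -> (n < B)%nat) ->
  vsum (fun n => vsel (p n) (f n)) M = vsum (fun n => vsel (p n && Nat.ltb n M) (f n)) B.
Proof.
  intros H. rewrite (vsum_trunc p f M (max M B)) by lia.
  rewrite (vsum_trunc (fun n => (p n && Nat.ltb n M)%bool) f B (max M B)) by lia.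
  apply vsum_ext. intros n _. f_equal. destruct (p n) eqn:E; [|reflexivity].
  apply H in E. destruct (Nat.ltb_spec n B); [|lia]. now rewrite Bool.andb_true_r.
Qed.

Section UniformSeries.
Context {X : NormedSpace} (HB : Banach X) (t : nat -> nat -> X).
Context (Hsmall : forall eps, eps > 0 -> exists N, forall (p : nat -> bool) M,
  (forall n, p n = true -> (N <= n)%nat) ->
  ev (fun k => vnorm (vsum (fun n => vsel (p n) (t n k)) M) < eps)).

(* The same delay is used for all the terms of a block, so that the control of the sums over a block at a common large index k holds for every k. The blocks are chosen to make these sums geometrically small. *)
Lemma delayed_tails_small : exists kappa : nat -> nat, forall eps, eps > 0 ->
  exists N, forall (p : nat -> bool) M k, (forall n, p n = true -> (N <= n)%nat) ->
    vnorm (vsum (fun n => vsel (p n) (t n (max k (kappa n)))) M) <= eps.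
Proof.
  destruct (choice (fun i N => forall (p : nat -> bool) M, (forall n, p n = true -> (N <= n)%nat) ->
     ev (fun k => vnorm (vsum (fun n => vsel (p n) (t n k)) M) < (1/2) ^ i))) as [N HN].
  { intros i. apply Hsmall. apply pow_lt. lra. }
  set (B := fix B i := match i with O => N O | S i => S (max (B i) (N (S i))) end).
  assert (HBN : forall i, (N i <= B i)%nat) by (intros [|i]; simpl; lia).
  assert (HBS : strictly_incr B) by (intros i; simpl; lia).
  (* A block has finitely many subsets, so one threshold [K i] serves all selections in block i. *)
  destruct (choice (fun i K => forall k, (K <= k)%nat -> forall p : nat -> bool, (forall n, p n = true -> (B i <= n)%nat) ->
     vnorm (vsum (fun n => vsel (p n) (t n k)) (B (S i))) < (1/2) ^ i)) as [K HK].
  { intros i.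
    destruct (ev_forall_selection (B (S i)) (fun p k => 
       vnorm (vsum (fun n => vsel (p n && Nat.leb (B i) n) (t n k)) (B (S i))) < (1/2) ^ i)) as [K HK].
    - intros p p' k Hp Hk. erewrite vsum_ext; [apply Hk|]. intros n Hn. cbv beta. now rewrite Hp.
    - intros p. apply HN. intros n Hn. apply andb_prop in Hn. destruct Hn as [_ Hn].
      apply Nat.leb_le in Hn. specialize (HBN i). lia.
    - exists K. intros k Hk p Hp. erewrite vsum_ext; [apply (HK k Hk p)|]. intros n Hn. cbv beta.
      destruct (p n) eqn:E; [|reflexivity]. apply Hp in E. destruct (Nat.leb_spec (B i) n); [reflexivity|lia]. }
  destruct (choice (fun n kap => forall i, (B i <= n < B (S i))%nat -> kap = K i)) as [kappa Hkappa].
  { intros n. destruct (classic (exists i, (B i <= n < B (S i))%nat)) as [[i Hi]|H].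
    - exists (K i). intros j Hj. f_equal.
      destruct (Nat.lt_trichotomy i j) as [L|[L|L]]; auto.
      + assert (B (S i) <= B j)%nat; [|lia].
        destruct (Nat.eq_dec (S i) j) as [<-|]; [lia|]. apply Nat.lt_le_incl, strictly_incr_lt; auto; lia.
      + assert (B (S j) <= B i)%nat; [|lia].
        destruct (Nat.eq_dec (S j) i) as [<-|]; [lia|]. apply Nat.lt_le_incl, strictly_incr_lt; auto; lia.
    - exists O. intros i Hi. destruct H; eauto. }
  exists kappa.
  (* Induction on the number of blocks: the first costs (1/2)^i, the others twice (1/2)^(i+1). The
     bound does not depend on how many there are. *)
  assert (Main : forall J i (p : nat -> bool) M k, (forall n, p n = true -> (B i <= n < B (i + J))%nat) ->
    vnorm (vsum (fun n => vsel (p n) (t n (max k (kappa n)))) M) <= 2 * (1/2) ^ i).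
  { induction J as [|J IH]; intros i p M k Hp.
    - rewrite vsum_zero.
      + rewrite vnorm_zero. assert (0 < (1/2) ^ i) by (apply pow_lt; lra). lra.
      + intros n _. destruct (p n) eqn:E; [|reflexivity]. apply Hp in E. rewrite Nat.add_0_r in E. lia.
    - set (p1 := fun n => (p n && Nat.ltb n (B (S i)))%bool).
      assert (H1 : forall n, p1 n = true -> (B i <= n < B (S i))%nat).
      { intros n Hn. apply andb_prop in Hn. destruct Hn as [Hn Hn']. apply Hp in Hn. apply Nat.ltb_lt in Hn'. lia. }
      rewrite (vsum_split p1 p) by (intros n _ Hn; now apply andb_prop in Hn).
      eapply Rle_trans; [apply vnorm_triangle|].
      assert (I1 : vnorm (vsum (fun n => vsel (p1 n) (t n (max k (kappa n)))) M) <= (1/2) ^ i).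
      { rewrite (vsum_support p1 _ M (B (S i))) by (intros n Hn; now apply H1 in Hn).
        erewrite vsum_ext; [apply Rlt_le, (HK i (max k (K i)) ltac:(lia) (fun n => (p1 n && Nat.ltb n M)%bool))|].
        - intros n Hn. apply andb_prop in Hn. now apply H1.
        - intros n Hn. cbv beta. destruct (p1 n) eqn:E; [|reflexivity]. apply H1 in E. now rewrite (Hkappa n i E). }
      assert (I2 := IH (S i) (fun n => (p n && negb (p1 n))%bool) M k).
      simpl pow in I2. apply (Rle_trans _ ((1/2) ^ i + 2 * (1 / 2 * (1 / 2) ^ i))); [|lra].
      apply Rplus_le_compat; auto. apply I2.
      intros n Hn. apply andb_prop in Hn. destruct Hn as [Hn Hn'].
      assert (Hn2 := Hp n Hn). unfold p1 in Hn'. rewrite Hn in Hn'. simpl in Hn'.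
      apply Bool.negb_true_iff, Nat.ltb_ge in Hn'. rewrite Nat.add_succ_r in Hn2. simpl. simpl in Hn', Hn2. lia. }
  intros eps He. destruct (half_pow_small eps He) as [i Hi].
  exists (B i). intros p M k Hp. apply (Rle_trans _ (2 * (1/2) ^ i)); auto.
  rewrite (vsum_trunc p _ M M) by lia.
  apply (Main M). intros n Hn. apply andb_prop in Hn. destruct Hn as [Hn Hn']. apply Hp in Hn.
  apply Nat.ltb_lt in Hn'. pose proof (strictly_incr_ge _ HBS (i + M)). lia.
Qed.

(** Allowing every selection that contains an initial segment encodes unconditional convergence;
    choosing [N] before k makes it uniform. *)
Lemma delayed_series : exists (kappa : nat -> nat) (s : nat -> X), forall eps, eps > 0 ->
  exists N, forall (p : nat -> bool) M k, (N <= M)%nat -> (forall n, (n < N)%nat -> p n = true) ->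
    vnorm (vsub (vsum (fun n => vsel (p n) (t n (max k (kappa n)))) M) (s k)) <= eps.
Proof.
  destruct delayed_tails_small as [kappa Hk].
  assert (Tail : forall eps, eps > 0 -> exists N, forall (p : nat -> bool) M k, (forall n, (n < N)%nat -> p n = true) ->
    vnorm (vsub (vsum (fun n => t n (max k (kappa n))) M) (vsum (fun n => vsel (p n) (t n (max k (kappa n)))) M)) <= eps).
  { intros eps He. destruct (Hk eps He) as [N HN]. exists N. intros p M k Hp.
    change (fun n => t n (Nat.max k (kappa n))) with (fun n => vsel ((fun _ : nat => true) n) (t n (Nat.max k (kappa n)))).
    rewrite (vsum_split p (fun _ => true)) by auto. cbv beta.
    match goal with |- vnorm (vsub (vadd ?a ?b) ?a) <= _ => replace (vsub (vadd a b) a) with b by vlin end.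
    apply (HN (fun n => (true && negb (p n))%bool)). intros n Hn. destruct (Nat.lt_ge_cases n N) as [L|]; auto.
    rewrite Hp in Hn by auto. discriminate. }
  assert (Cau : forall eps, eps > 0 -> exists N, forall M M' k, (N <= M)%nat -> (N <= M')%nat ->
    vnorm (vsub (vsum (fun n => t n (max k (kappa n))) M) (vsum (fun n => t n (max k (kappa n))) M')) <= eps).
  { intros eps He. destruct (Tail eps He) as [N HN]. exists N.
    assert (W : forall M M' k, (N <= M)%nat -> (M <= M')%nat ->
      vnorm (vsub (vsum (fun n => t n (max k (kappa n))) M') (vsum (fun n => t n (max k (kappa n))) M)) <= eps).
    { intros M M' k HM HMM.
      replace (vsum (fun n => t n (max k (kappa n))) M)
        with (vsum (fun n => vsel (true && Nat.ltb n M) (t n (max k (kappa n)))) M')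
        by (symmetry; apply (vsum_trunc (fun _ => true) (fun n => t n (max k (kappa n))) M M' HMM)).
      apply (HN (fun n => (true && Nat.ltb n M)%bool)). intros n Hn. apply Nat.ltb_lt. lia. }
    intros M M' k HM HM'. destruct (Nat.le_ge_cases M M').
    - rewrite vnorm_sub_sym. now apply W.
    - now apply W. }
  destruct (choice (fun k l => norm_cv (fun M => vsum (fun n => t n (max k (kappa n))) M) l)) as [s Hs].
  { intros k. apply HB. intros eps He. destruct (Cau (eps / 2) ltac:(lra)) as [N HN].
    exists N. intros m n Hm Hn. specialize (HN m n k Hm Hn). lra. }
  exists kappa, s. intros eps He.
  destruct (Tail (eps / 3) ltac:(lra)) as [N1 H1]. destruct (Cau (eps / 3) ltac:(lra)) as [N2 H2].
  exists (max N1 N2). intros p M k HM Hp.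
  destruct (ev_ex _ (ev_and _ _ (ev_ge N2) (proj1 (norm_cv_ev _ _) (Hs k) (eps / 3) ltac:(lra)))) as (M' & K1 & K2).
  specialize (H1 p M k ltac:(intros; apply Hp; lia)).
  specialize (H2 M M' k ltac:(lia) K1). rewrite vnorm_sub_sym in H1.
  set (x := vsum (fun n => vsel (p n) (t n (Nat.max k (kappa n)))) M) in *.
  set (y := vsum (fun n => t n (Nat.max k (kappa n))) M) in *.
  set (z := vsum (fun n => t n (Nat.max k (kappa n))) M') in *.
  pose proof (vnorm_sum (vsub x (s k)) (vsub x y) (vsub y (s k)) ltac:(vlin)).
  pose proof (vnorm_sum (vsub y (s k)) (vsub y z) (vsub z (s k)) ltac:(vlin)).
  lra.
Qed.

End UniformSeries.

(** A nonzero Delta-limit of moved remainders would give a nearby one for some [r (S n)] along the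
    same dislocations, too large for maximality. Eventual closeness suffices, since n is fixed
    before the last subsequence is taken. *)
Lemma remainder_null {X : NormedSpace} (HB : Banach X) (HUC : uniformly_convex X)
  (D0 D : (X -> X) -> Prop) (HD0 : dislocation_group D0) (HDsub : forall g, D g -> D0 g)
  (r : nat -> nat -> X) (w : nat -> X) (rho : nat -> X) :
  bounded_seq rho ->
  (forall eps, eps > 0 -> exists N, forall n, (N <= n)%nat -> vnorm (w n) < eps) ->
  (forall eps, eps > 0 -> exists N, forall n, (N <= n)%nat -> ev (fun k => vnorm (vsub (rho k) (r n k)) <= eps)) ->
  (forall n s gam v, strictly_incr s -> (forall k, D (gam k)) ->
     delta_cv (fun k => inv (gam k) (r (S n) (s k))) v -> vnorm v <= 2 * vnorm (w (S n))) ->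
  (forall n, bounded_seq (r n)) ->
  D_delta_cv D rho vzero.
Proof.
  intros [C HC] Hw Hr Hmax Hb gam h HD Hh.
  assert (HC0 : 0 <= C) by (eapply Rle_trans; [apply (vnorm_nonneg (rho O))|apply HC]).
  assert (Hgi : forall k, D0 (inv (gam k))) by (intros k; apply (D0_inv D0 HD0); auto).
  assert (E : forall k, h k (vsub (rho k) vzero) = inv (gam k) (rho k)).
  { intros k. rewrite (inverse_eq_inv D0 HD0 (gam k) (h k)); auto. now rewrite vsub_0_r. }
  apply delta_cv0_ev. intros y eps He. apply NNPP. intros K.
  destruct (not_ev_subseq _ K) as [s [Hs Hs']].
  destruct (delta_compact HB HUC (fun j => inv (gam (s j)) (rho (s j)))) as (s1 & v & Hs1 & Hv).
  { exists C. intros k. rewrite (D0_norm D0 HD0); auto. }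
  assert (Hv0 : v <> vzero).
  { intros ->. destruct (ev_ex _ (proj1 (delta_cv0_ev _) Hv y eps He)) as [k Hk].
    apply (Hs' (s1 k)). now rewrite !E. }
  apply vnorm_pos in Hv0.
  destruct (delta_limit_perturb HUC (C + 1) (vnorm v / 2)) as (e & He' & P); [lra|lra|].
  (* The two limits differ by less than half the norm of [v], and maximality bounds the second by a
     quarter, which does not add up to that norm. *)
  destruct (Hr e He') as [N1 HN1]. destruct (Hw (vnorm v / 8) ltac:(lra)) as [N2 HN2].
  set (n := max N1 N2).
  destruct (Hb (S n)) as [C' HC'].
  destruct (delta_compact HB HUC (fun j => inv (gam (s (s1 j))) (r (S n) (s (s1 j))))) as (s2 & v' & Hs2 & Hv').
  { exists C'. intros k. rewrite (D0_norm D0 HD0); auto. }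
  assert (Hs3 : strictly_incr (fun j => s (s1 (s2 j)))).
  { apply (strictly_incr_comp s (fun j => s1 (s2 j))); auto. now apply strictly_incr_comp. }
  assert (I1 : vnorm (vsub v v') < vnorm v / 2).
  { apply (P (fun j => inv (gam (s (s1 (s2 j)))) (rho (s (s1 (s2 j)))))
             (fun j => inv (gam (s (s1 (s2 j)))) (r (S n) (s (s1 (s2 j)))))); auto.
    - apply ev_all. intros k. rewrite (D0_norm D0 HD0) by auto. specialize (HC (s (s1 (s2 k)))). lra.
    - exact (delta_cv_sub1 _ v s2 Hs2 Hv).
    - assert (A := ev_sub1 _ _ Hs3 (HN1 (S n) ltac:(unfold n; lia))).
      apply (ev_imp _ _ A). intros k Hk.
      rewrite <- linear_sub by (apply (D0_linear D0 HD0); auto). now rewrite (D0_norm D0 HD0). }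
  assert (I2 := Hmax n _ (fun j => gam (s (s1 (s2 j)))) v' Hs3 (fun k => HD _) Hv').
  specialize (HN2 (S n) ltac:(unfold n; lia)).
  pose proof (vnorm_sum v (vsub v v') v' ltac:(vlin)). lra.
Qed.

(** * Weak compactness and Opial's condition *)

Section NormingFunctional.
Context {X : NormedSpace} (HUS : uniformly_smooth X).
Implicit Types x y z : X.

Lemma smooth_at z y eps : vnorm z = 1 -> eps > 0 ->
  exists t0, t0 > 0 /\ forall t, 0 < t < t0 ->
    vnorm (vadd z (vscal t y)) + vnorm (vsub z (vscal t y)) - 2 <= eps * t.
Proof.
  intros Hz He. destruct (classic (y = vzero)) as [->|Hy].
  { exists 1. split; [lra|]. intros t Ht. rewrite vscal_0r, vsub_0_r, vadd_0_r. nra. }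
  apply vnorm_pos in Hy.
  destruct (HUS (eps / (2 * vnorm y))) as (t0 & Ht0 & H); [apply Rdiv_lt_0_compat; lra|].
  exists (t0 / vnorm y). split; [apply Rdiv_lt_0_compat; lra|]. intros t Ht.
  assert (Hi : 0 < / vnorm y) by now apply Rinv_0_lt_compat.
  assert (K := H (t * vnorm y)).
  assert (Hlt : 0 < t * vnorm y < t0).
  { split; [apply Rmult_lt_0_compat; lra|].
    replace t0 with (t0 / vnorm y * vnorm y) by (field; lra). apply Rmult_lt_compat_r; lra. }
  specialize (K Hlt z (vscal (/ vnorm y) y) Hz).
  rewrite <- vscal_mul in K. replace (t * vnorm y * / vnorm y) with t in K by (field; lra).
  replace (eps / (2 * vnorm y) * (t * vnorm y)) with (eps * t / 2) in K by (field; lra).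
  specialize (K ltac:(rewrite vnorm_scal_pos by lra; field; lra)). lra.
Qed.

Definition slope z y t := (vnorm (vadd z (vscal t y)) - vnorm z) / t.

Lemma slope_mul z y t : t > 0 -> vnorm (vadd z (vscal t y)) = vnorm z + t * slope z y t.
Proof. intros H. unfold slope. field. lra. Qed.

(** This is convexity of the norm: [z + s y] is a convex combination of [z] and [z + t y]. *)
Lemma slope_mono z y s t : 0 < s -> s <= t -> slope z y s <= slope z y t.
Proof.
  intros Hs Hst. apply (Rmult_le_reg_l s); auto.
  assert (E1 := slope_mul z y s Hs). assert (E2 := slope_mul z y t ltac:(lra)).
  assert (H : vnorm (vadd z (vscal s y)) <= vnorm (vscal (1 - s / t) z) + vnorm (vscal (s / t) (vadd z (vscal t y)))).
  { apply vnorm_sum. vlin. }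
  assert (0 <= s / t <= 1).
  { split; [apply Rlt_le, Rdiv_lt_0_compat; lra|]. apply (Rmult_le_reg_r t); [lra|].
    unfold Rdiv. rewrite Rmult_assoc, Rinv_l by lra. lra. }
  rewrite !vnorm_scal_pos, E1, E2 in H by lra.
  replace (s / t * (vnorm z + t * slope z y t)) with (s / t * vnorm z + s * slope z y t) in H by (field; lra).
  lra.
Qed.

Lemma slope_bound z y t : t > 0 -> - vnorm y <= slope z y t <= vnorm y.
Proof.
  intros Ht. assert (E := slope_mul z y t Ht).
  pose proof (vnorm_triangle X z (vscal t y)) as H1.
  pose proof (vnorm_diff z (vadd z (vscal t y)) (vscal t y) ltac:(vlin)) as H2.
  rewrite vnorm_scal_pos in H1, H2 by lra. nra.
Qed.

(* The one-sided directional derivative of the norm is sublinear, and smoothness makes it odd, hence linear. *)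
Lemma norming_functional z : exists f : X -> R,
  bounded_linear_functional f /\ (forall y, Rabs (f y) <= vnorm y) /\ f z = vnorm z.
Proof.
  destruct (classic (z = vzero)) as [->|Hz].
  { exists (fun _ => 0). repeat split; intros; rewrite ?Rabs_R0, ?vnorm_zero; try ring; try apply vnorm_nonneg.
    exists 0. intros x. lra. }
  assert (Hn := vnorm_pos _ Hz).
  (* Uniform smoothness speaks of unit vectors, so the norm is differentiated at the normalized
     point. *)
  set (e := vscal (/ vnorm z) z).
  assert (Hi : 0 < / vnorm z) by now apply Rinv_0_lt_compat.
  assert (He : vnorm e = 1) by (unfold e; rewrite vnorm_scal_pos by lra; field; lra).
  set (S := fun y q => exists t, t > 0 /\ q = slope e y t).
  destruct (choice (fun y m => is_glb (S y) m)) as [f Hf].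
  { intros y. apply (glb_exists _ (- vnorm y)).
    - exists (slope e y 1), 1. split; [lra|auto].
    - intros s (t & Ht & ->). now apply slope_bound. }
  assert (Low : forall y t, t > 0 -> f y <= slope e y t).
  { intros y t Ht. apply (Hf y). now exists t. }
  assert (Approx : forall y eps, eps > 0 -> exists t0, t0 > 0 /\ forall t, 0 < t <= t0 -> slope e y t < f y + eps).
  { intros y eps Heps. destruct (glb_approx _ _ _ (Hf y) Heps) as (s & (t0 & Ht0 & ->) & Hs).
    exists t0. split; auto. intros t Ht. apply (Rle_lt_trans _ (slope e y t0)); auto.
    apply slope_mono; lra. }
  assert (Sub : forall y y', f (vadd y y') <= f y + f y').
  { intros y y'. apply le_epsilon. intros eps Heps.
    destruct (Approx y (eps / 2) ltac:(lra)) as (t1 & Ht1 & H1).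
    destruct (Approx y' (eps / 2) ltac:(lra)) as (t2 & Ht2 & H2).
    set (t := Rmin t1 t2). assert (Ht : 0 < t) by (apply Rmin_glb_lt; lra).
    assert (t <= t1) by apply Rmin_l. assert (t <= t2) by apply Rmin_r.
    specialize (H1 t ltac:(lra)). specialize (H2 t ltac:(lra)).
    (* The step is halved because [e + (t/2)(y + y')] is the midpoint of [e + t y] and
       [e + t y']. *)
    apply (Rle_trans _ (slope e (vadd y y') (t / 2))); [apply Low; lra|].
    apply (Rle_trans _ (slope e y t + slope e y' t)); [|lra].
    apply (Rmult_le_reg_l (t / 2)); [lra|].
    assert (E0 := slope_mul e (vadd y y') (t / 2) ltac:(lra)).
    assert (E1 := slope_mul e y t Ht). assert (E2 := slope_mul e y' t Ht).
    pose proof (vnorm_sum (vadd e (vscal (t / 2) (vadd y y'))) (vscal (1/2) (vadd e (vscal t y)))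
      (vscal (1/2) (vadd e (vscal t y'))) ltac:(vlin)) as T.
    rewrite !vnorm_scal_pos in T by lra. lra. }
  assert (Odd : forall y, f (vopp y) = - f y).
  { intros y. apply Rle_antisym.
    - apply le_epsilon. intros eps Heps. destruct (smooth_at e y eps He Heps) as (t0 & Ht0 & H).
      specialize (H (t0 / 2) ltac:(lra)).
      assert (E1 := slope_mul e y (t0 / 2) ltac:(lra)). assert (E2 := slope_mul e (vopp y) (t0 / 2) ltac:(lra)).
      replace (vadd e (vscal (t0 / 2) (vopp y))) with (vsub e (vscal (t0 / 2) y)) in E2 by vlin.
      assert (L1 := Low y (t0 / 2) ltac:(lra)). assert (L2 := Low (vopp y) (t0 / 2) ltac:(lra)).
      assert (slope e y (t0 / 2) + slope e (vopp y) (t0 / 2) <= eps); [|lra].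
      apply (Rmult_le_reg_l (t0 / 2)); lra.
    - assert (Z : 0 <= f vzero).
      { apply (Hf vzero). intros s (t & Ht & ->). unfold slope. rewrite vscal_0r, vadd_0_r. 
        right. field. lra. }
      pose proof (Sub y (vopp y)) as T. rewrite vadd_opp in T. lra. }
  assert (Add : forall y y', f (vadd y y') = f y + f y').
  { intros y y'. apply Rle_antisym; [apply Sub|].
    pose proof (Sub (vopp y) (vopp y')) as T. rewrite !Odd in T.
    replace (vadd (vopp y) (vopp y')) with (vopp (vadd y y')) in T by vlin. rewrite Odd in T. lra. }
  assert (Pos : forall b y, b > 0 -> f (vscal b y) = b * f y).
  { assert (W : forall b y, b > 0 -> f (vscal b y) <= b * f y).
    { intros b y Hb. apply (Rmult_le_reg_l (/ b)); [now apply Rinv_0_lt_compat|].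
      replace (/ b * (b * f y)) with (f y) by (field; lra).
      apply (Hf y). intros s (t & Ht & ->).
      apply (Rmult_le_reg_l b); auto. rewrite <- Rmult_assoc, Rinv_r, Rmult_1_l by lra.
      apply (Rle_trans _ (slope e (vscal b y) (t / b))); [apply Low; apply Rdiv_lt_0_compat; lra|].
      right. unfold slope. rewrite <- vscal_mul.
      replace (t / b * b) with t by (field; lra). field. split; lra. }
    intros b y Hb. apply Rle_antisym; auto.
    assert (T := W (/ b) (vscal b y) ltac:(now apply Rinv_0_lt_compat)).
    rewrite <- vscal_mul, Rinv_l, vscal_1 in T by lra.
    apply (Rmult_le_reg_l (/ b)); [now apply Rinv_0_lt_compat|].
    replace (/ b * (b * f y)) with (f y) by (field; lra). exact T. }
  assert (F0 : f vzero = 0) by (pose proof (Add vzero vzero) as T; rewrite vadd_0 in T; lra).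
  assert (Scal : forall b y, f (vscal b y) = b * f y).
  { intros b y. destruct (Rtotal_order b 0) as [L|[->|L]]; [|rewrite vscal_0l, F0; ring|now apply Pos].
    replace (vscal b y) with (vopp (vscal (- b) y)) by vlin. rewrite Odd, Pos by lra. ring. }
  assert (Bd : forall y, Rabs (f y) <= vnorm y).
  { assert (W : forall y, f y <= vnorm y).
    { intros y. apply (Rle_trans _ (slope e y 1)); [apply Low; lra|]. apply slope_bound. lra. }
    intros y. apply Rabs_le. split; [|apply W]. specialize (W (vopp y)). rewrite Odd, vnorm_opp in W. lra. }
  exists f. repeat split; auto.
  - exists 1. intros x. rewrite Rmult_1_l. apply Bd.
  - replace z with (vscal (vnorm z) e) at 1
      by (unfold e; rewrite <- vscal_mul, Rinv_r, vscal_1 by lra; reflexivity).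
    rewrite Scal. assert (f e = 1); [|nra].
    apply Rle_antisym.
    + rewrite <- He. eapply Rle_trans; [apply Rle_abs|]. apply Bd.
    + apply (Hf e). intros s (t & Ht & ->). right. unfold slope.
      replace (vadd e (vscal t e)) with (vscal (1 + t) e) by vlin.
      rewrite vnorm_scal_pos, He by lra. field. lra.
Qed.

End NormingFunctional.

Section WeakCompactness.
Context {X : NormedSpace} (HB : Banach X) (HUC : uniformly_convex X) (HUS : uniformly_smooth X).

(** Midpoints alone replace convex combinations: they are all that uniform convexity uses, and they
    keep the hull of a sequence countable. *)
Inductive midpoint_hull (A : X -> Prop) : X -> Prop :=
  | hull_base y : A y -> midpoint_hull A y
  | hull_mid y z : midpoint_hull A y -> midpoint_hull A z -> midpoint_hull A (mid y z).

Lemma midpoint_hull_sub (A B : X -> Prop) y : (forall z, A z -> B z) -> midpoint_hull A y -> midpoint_hull B y.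
Proof. intros H K. induction K; [now apply hull_base, H|now apply hull_mid]. Qed.

(* Nearly minimal-norm points of the hulls of the tails form a Cauchy sequence. *)
Lemma tail_hulls_meet (x : nat -> X) : bounded_seq x ->
  exists p, exists y : nat -> X, norm_cv y p /\
    forall n, midpoint_hull (fun z => exists k, (n <= k)%nat /\ z = x k) (y n).
Proof.
  intros [C HC].
  set (T := fun n z => exists k, (n <= k)%nat /\ z = x k).
  destruct (choice (fun n m => is_glb (fun s => exists y, midpoint_hull (T n) y /\ s = vnorm y) m)) as [m Hm].
  { intros n. apply (glb_exists _ 0).
    - exists (vnorm (x n)), (x n). split; auto. apply hull_base. exists n. auto.
    - intros s (y & _ & ->). apply vnorm_nonneg. }
  assert (HmC : forall n, m n <= C).
  { intros n. apply (Rle_trans _ (vnorm (x n))); auto. apply (Hm n). exists (x n). split; auto.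
    apply hull_base. exists n; auto. }
  destruct (choice (fun n y => midpoint_hull (T n) y /\ vnorm y < m n + / INR (S n))) as [y Hy].
  { intros n. destruct (glb_approx _ _ _ (Hm n) (inv_INR_pos n)) as (s & (y & Hy & ->) & Hs). eauto. }
  destruct (completeness (fun s => exists n, s = m n)) as [ms [Hms1 Hms2]].
  { exists C. intros s [n ->]. auto. }
  { exists (m O), O; auto. }
  assert (Hmono : forall i j, (i <= j)%nat -> forall z, midpoint_hull (T j) z -> midpoint_hull (T i) z).
  { intros i j Hij z. apply midpoint_hull_sub. intros u (k & Hk & ->). exists k. split; [lia|auto]. }
  assert (Hms0 : 0 <= ms).
  { apply (Rle_trans _ (m O)); [|apply Hms1; eauto]. apply (Hm O). intros s (z & _ & ->). apply vnorm_nonneg. }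
  destruct (HB y) as [p Hp].
  { intros eps He. destruct (midpoint_gap HUC (ms + 1) eps) as (d & Hd & G); [lra|auto|].
    (* The hulls shrink, so their least norms increase to [ms]. Past [N1] both points and their
       midpoint lie in one hull, where norms exceed [ms - d / 2]. *)
    assert (HN1 : exists N1, ms - d / 2 < m N1).
    { apply NNPP. intros K. assert (ms <= ms - d / 2); [|lra]. apply Hms2. intros s [n ->].
      apply Rnot_lt_le. intros L. apply K. eauto. }
    destruct HN1 as [N1 HN1].
    destruct (inv_INR_small (Rmin (d / 2) 1)) as [N2 HN2]; [apply Rmin_glb_lt; lra|].
    assert (Hup : forall i, (N2 <= i)%nat -> vnorm (y i) <= ms + Rmin (d / 2) 1).
    { intros i Hi. destruct (Hy i) as [_ Hi']. specialize (HN2 i Hi).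
      assert (m i <= ms) by (apply Hms1; eauto). lra. }
    exists (max N1 N2). intros i j Hi Hj. apply Rnot_le_lt. intros L.
    pose proof (Rmin_l (d / 2) 1). pose proof (Rmin_r (d / 2) 1).
    assert (M := G (ms + Rmin (d / 2) 1) (y i) (y j) ltac:(lra) (Hup i ltac:(lia)) (Hup j ltac:(lia)) L).
    assert (m N1 <= vnorm (mid (y i) (y j))); [|lra].
    apply (Hm N1). exists (mid (y i) (y j)). split; auto.
    apply hull_mid; [apply (Hmono N1 i)|apply (Hmono N1 j)]; try lia; apply Hy. }
  exists p, y. split; auto. intros n. apply Hy.
Qed.

Lemma functional_continuous (f : X -> R) (y : nat -> X) p :
  bounded_linear_functional f -> norm_cv y p -> Un_cv (fun n => f (y n)) (f p).
Proof.
  intros (HA & HS & [C HC]) Hy. apply Un_cv_ev. intros eps He.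
  assert (HC' : 0 < Rabs C + 1) by (pose proof (Rabs_pos C); lra).
  apply (ev_imp _ _ (proj1 (norm_cv_ev _ _) Hy (eps / (Rabs C + 1)) ltac:(apply Rdiv_lt_0_compat; lra))).
  intros n Hn.
  replace (f (y n) - f p) with (f (vsub (y n) p))
    by (unfold vsub; rewrite HA, vopp_scal, HS; ring).
  apply (Rle_lt_trans _ (C * vnorm (vsub (y n) p))); auto.
  pose proof (vnorm_nonneg (vsub (y n) p)). pose proof (Rle_abs C).
  apply (Rle_lt_trans _ ((Rabs C + 1) * vnorm (vsub (y n) p))); [nra|].
  apply (Rmult_lt_compat_l (Rabs C + 1)) in Hn; auto.
  replace ((Rabs C + 1) * (eps / (Rabs C + 1))) with eps in Hn by (field; lra). exact Hn.
Qed.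

Lemma functional_hull_ge (f : X -> R) (A : X -> Prop) c y :
  bounded_linear_functional f -> (forall z, A z -> c <= f z) -> midpoint_hull A y -> c <= f y.
Proof.
  intros (HA & HS & _) H K. induction K; auto. unfold mid. rewrite HS, HA. lra.
Qed.

Lemma functional_opp (f : X -> R) : bounded_linear_functional f -> bounded_linear_functional (fun x => - f x).
Proof.
  intros (HA & HS & [C HC]). repeat split.
  - intros. rewrite HA. ring.
  - intros. rewrite HS. ring.
  - exists C. intros. now rewrite Rabs_Ropp.
Qed.

(* Closing the sequence under differences and midpoints keeps it countable without rational coefficients. *)
Fixpoint gen (x : nat -> X) (s : nat) (n : nat) : X :=
  match s with
  | O => x n
  | S s => let (c, ab) := of_nat n in let (i, j) := of_nat ab in
      match c with
      | O => gen x s i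
      | S O => vsub (gen x s i) (gen x s j)
      | S (S _) => mid (gen x s i) (gen x s j)
      end
  end.

Lemma gen_mono x s s' i : (s <= s')%nat -> exists j, gen x s' j = gen x s i.
Proof.
  intros H. induction H as [|s' H [j Hj]]; [now exists i|].
  exists (to_nat (O, to_nat (j, O))). cbn [gen]. now rewrite !cancel_of_to.
Qed.

Lemma gen_sub x s s' i j : exists n, gen x (S (max s s')) n = vsub (gen x s i) (gen x s' j).
Proof.
  destruct (gen_mono x s (max s s') i ltac:(lia)) as [i' <-].
  destruct (gen_mono x s' (max s s') j ltac:(lia)) as [j' <-].
  exists (to_nat (1%nat, to_nat (i', j'))). cbn [gen]. now rewrite !cancel_of_to.
Qed.

Lemma gen_mid x s s' i j : exists n, gen x (S (max s s')) n = mid (gen x s i) (gen x s' j).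
Proof.
  destruct (gen_mono x s (max s s') i ltac:(lia)) as [i' <-].
  destruct (gen_mono x s' (max s s') j ltac:(lia)) as [j' <-].
  exists (to_nat (2%nat, to_nat (i', j'))). cbn [gen]. now rewrite !cancel_of_to.
Qed.

Definition enum (x : nat -> X) (n : nat) : X := let (s, i) := of_nat n in gen x s i.

Lemma enum_gen x s i : enum x (to_nat (s, i)) = gen x s i.
Proof. unfold enum. now rewrite cancel_of_to. Qed.

Lemma enum_hull x A y : (forall z, A z -> exists k, z = x k) -> midpoint_hull A y -> exists n, enum x n = y.
Proof.
  intros HA K. induction K as [y Hy|y z _ [n Hn] _ [m Hm]].
  - destruct (HA y Hy) as [k ->]. exists (to_nat (O, k)). now rewrite enum_gen.
  - unfold enum in Hn, Hm. destruct (of_nat n) as [s i], (of_nat m) as [s' j].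
    destruct (gen_mid x s s' i j) as [l Hl]. exists (to_nat (S (max s s'), l)).
    now rewrite enum_gen, Hl, Hn, Hm.
Qed.

Lemma enum_sub x n m : exists l, enum x l = vsub (enum x n) (enum x m).
Proof.
  unfold enum at 2 3. destruct (of_nat n) as [s i], (of_nat m) as [s' j].
  destruct (gen_sub x s s' i j) as [l Hl]. exists (to_nat (S (max s s'), l)). now rewrite enum_gen, Hl.
Qed.

(* Along a subsequence, countably many functionals, which norm the enumerated vectors, converge. They separate the points in which the hulls of the tails of any two further subsequences meet. *)
Lemma weak_compact (x : nat -> X) : bounded_seq x ->
  exists phi p, strictly_incr phi /\ weak_cv (fun k => x (phi k)) p.
Proof.
  intros [C HC].
  destruct (choice (fun n (f : X -> R) => bounded_linear_functional f /\ (forall y, Rabs (f y) <= vnorm y) /\ f (enum x n) = vnorm (enum x n))) as [f Hf].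
  { intros n. apply (norming_functional HUS). }
  destruct (dependent_choice (fun phi => strictly_incr phi)
    (fun n phi psi => sub psi phi /\ exists l, Un_cv (fun k => f n (x (psi k))) l) (fun k => k)) as [ph [_ Hph]].
  { intros k; lia. }
  { intros n phi Hp. destruct (bounded_real_subseq (fun k => f n (x (phi k))) C) as (s & l & Hs & Hl).
    - intros k. eapply Rle_trans; [apply (Hf n)|apply HC].
    - exists (fun k => phi (s k)). split; [now apply strictly_incr_comp|]. split; [now apply sub_comp|]. now exists l. }
  destruct (diagonal ph) as [d [Hd Hds]]; [apply Hph|apply Hph|].
  destruct (choice (fun n l => Un_cv (fun k => f n (x (d k))) l)) as [L HL].
  { intros n. destruct (Hph n) as [_ [_ [l Hl]]]. exists l. apply Un_cv_ev. intros eps He.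
    apply (sub_shift_ev (fun i => Rabs (f n (x i) - l) < eps) d (S n)).
    apply (ev_sub (fun i => Rabs (f n (x i) - l) < eps) (ph (S n))); [apply (Hph (S n))|apply Hds|].
    exact (proj1 (Un_cv_ev _ _) Hl eps He). }
  (* The meeting point is a limit of enumerated vectors, which lets their norming functionals detect
     it, and it lies in every closed half-space containing a tail. *)
  assert (Clust : forall s, strictly_incr s -> exists p,
     (forall eps, eps > 0 -> exists n, vnorm (vsub p (enum x n)) < eps) /\
     (forall h c, bounded_linear_functional h -> ev (fun k => c <= h (x (d (s k)))) -> c <= h p)).
  { intros s Hs. destruct (tail_hulls_meet (fun k => x (d (s k)))) as (p & y & Hy & Hull).
    { exists C. intros; apply HC. }
    exists p. split.
    - intros eps He. destruct (ev_ex _ (proj1 (norm_cv_ev _ _) Hy eps He)) as [n Hn].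
      assert (Hm : exists m, enum x m = y n).
      { refine (enum_hull x _ _ _ (Hull n)). intros z (k & _ & ->). now exists (d (s k)). }
      destruct Hm as [m Hm].
      exists m. now rewrite Hm, vnorm_sub_sym.
    - intros h c Hh [N HN]. apply (Un_cv_ge_const _ _ _ (functional_continuous h y p Hh Hy)).
      exists N. intros n Hn. refine (functional_hull_ge h _ c _ Hh _ (Hull n)).
      intros z (k & Hk & ->). apply HN. lia. }
  assert (Val : forall s p, strictly_incr s -> 
     (forall h c, bounded_linear_functional h -> ev (fun k => c <= h (x (d (s k)))) -> c <= h p) ->
     forall n, f n p = L n).
  { intros s p Hs Hp n. assert (HLs := Un_cv_sub1 _ _ _ Hs (HL n)). rewrite Un_cv_ev in HLs.
    apply Rle_antisym; apply le_epsilon; intros eps He.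
    - assert (- (L n + eps) <= - f n p); [|lra].
      apply (Hp (fun z => - f n z)); [apply functional_opp, Hf|].
      apply (ev_imp _ _ (HLs eps He)). intros k Hk. apply Rabs_def2 in Hk. lra.
    - assert (L n - eps <= f n p); [|lra].
      apply (Hp (f n)); [apply Hf|].
      apply (ev_imp _ _ (HLs eps He)). intros k Hk. apply Rabs_def2 in Hk. lra. }
  destruct (Clust (fun k => k)) as (p & Hp1 & Hp2); [intros k; lia|].
  assert (HLp := Val (fun k => k) p ltac:(intros k; lia) Hp2).
  (* The difference q - p is close to an enumerated vector, whose norming functional vanishes on q -
     p by [Val]; so that vector, and with it the difference, is small. *)
  assert (Uniq : forall s q, strictly_incr s -> (forall eps, eps > 0 -> exists n, vnorm (vsub q (enum x n)) < eps) ->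
     (forall h c, bounded_linear_functional h -> ev (fun k => c <= h (x (d (s k)))) -> c <= h q) -> q = p).
  { intros s q Hs Hq1 Hq2. assert (HLq := Val s q Hs Hq2).
    apply vsub_eq0, vnorm_eq0. apply Rle_antisym; [|apply vnorm_nonneg].
    apply le_epsilon. intros eps He.
    destruct (Hq1 (eps / 4) ltac:(lra)) as [n Hn]. destruct (Hp1 (eps / 4) ltac:(lra)) as [m Hm].
    destruct (enum_sub x n m) as [l Hl].
    destruct (Hf l) as ((HA & HS & _) & Hb & Hz).
    assert (Hd' : vnorm (vsub (vsub q p) (enum x l)) < eps / 2).
    { pose proof (vnorm_diff (vsub (vsub q p) (enum x l)) (vsub q (enum x n)) (vsub p (enum x m)) ltac:(rewrite Hl; vlin)). lra. }
    assert (F0 : f l (vsub q p) = 0).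
    { unfold vsub. rewrite HA, vopp_scal, HS, HLp, HLq. ring. }
    assert (vnorm (enum x l) <= vnorm (vsub (vsub q p) (enum x l))).
    { rewrite <- Hz. replace (f l (enum x l)) with (- f l (vsub (vsub q p) (enum x l))).
      - eapply Rle_trans; [apply Rle_abs|]. rewrite Rabs_Ropp. apply Hb.
      - unfold vsub at 1. rewrite HA, F0, vopp_scal, HS. ring. }
    pose proof (vnorm_sum (vsub q p) (vsub (vsub q p) (enum x l)) (enum x l) ltac:(vlin)). lra. }
  exists d, p. split; auto.
  (* Were [h] too large along a subsequence, the meeting point of its hulls, which is again p, would
     lie in the half-space where [h] is at least h p + eps. *)
  assert (Half : forall h, bounded_linear_functional h -> forall eps, eps > 0 -> ev (fun k => h (x (d k)) < h p + eps)).
  { intros h Hh eps He. apply NNPP. intros K. destruct (not_ev_subseq _ K) as [s [Hs Hs']].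
    destruct (Clust s Hs) as (q & Hq1 & Hq2). assert (E := Uniq s q Hs Hq1 Hq2). subst q.
    assert (h p + eps <= h p); [|lra]. apply Hq2; auto.
    apply ev_all. intros k. specialize (Hs' k). lra. }
  intros h Hh. apply Un_cv_ev. intros eps He.
  apply (ev_imp2 _ _ _ (Half h Hh eps He) (Half (fun z => - h z) (functional_opp h Hh) eps He)).
  intros k K1 K2. apply Rabs_def1; lra.
Qed.

Lemma weak_cv_sub1 (x : nat -> X) l s : strictly_incr s -> weak_cv x l -> weak_cv (fun k => x (s k)) l.
Proof. intros Hs H f Hf. exact (Un_cv_sub1 (fun k => f (x k)) (f l) s Hs (H f Hf)). Qed.

(** Opial's condition compares lower limits, Delta-convergence an upper limit of differences. On a
    subsequence violating the latter, along which the distances to y converge, the two become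
    comparable. *)
Lemma opial_weak_delta (HO : Opial X) (x : nat -> X) p : bounded_seq x -> weak_cv x p -> delta_cv x p.
Proof.
  intros [C HC] Hp. apply delta_cv_ev. intros y eps He. apply NNPP. intros K.
  destruct (not_ev_subseq _ K) as [s [Hs Hs']].
  destruct (bounded_real_subseq (fun k => vnorm (vsub (x (s k)) y)) (C + vnorm y)) as (t & l & Ht & Hl).
  { intros k. rewrite Rabs_right by apply Rle_ge, vnorm_nonneg.
    pose proof (vnorm_diff _ (x (s k)) y eq_refl). specialize (HC (s k)). lra. }
  assert (Hst : strictly_incr (fun k => s (t k))) by now apply strictly_incr_comp.
  assert (Hw := weak_cv_sub1 x p _ Hst Hp). rewrite Un_cv_ev in Hl.
  destruct (HO _ p Hw y l) as (c & Hc & N & HN).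
  - exists (l + eps / 2). split; [lra|].
    destruct (Hl (eps / 2) ltac:(lra)) as [N HN]. exists N. intros n Hn.
    specialize (HN n Hn). apply Rabs_def2 in HN. specialize (Hs' (t n)). lra.
  - destruct (ev_ex _ (ev_and _ _ (ev_ge N) (Hl (c - l) ltac:(lra)))) as (n & Hn & Hn').
    specialize (HN n Hn). apply Rabs_def2 in Hn'. lra.
Qed.

(** A weak limit of any subsequence is also its Delta-limit under Opial's condition, hence 0 by
    uniqueness; weak compactness supplies such limits. *)
Lemma opial_delta_weak (HO : Opial X) (x : nat -> X) : bounded_seq x -> delta_cv x vzero -> weak_cv x vzero.
Proof.
  intros [C HC] Hx f Hf. apply Un_cv_ev. intros eps He. apply NNPP. intros K.
  destruct (not_ev_subseq _ K) as [s [Hs Hs']].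
  destruct (weak_compact (fun k => x (s k))) as (t & p & Ht & Hp).
  { exists C. intros; apply HC. }
  assert (Hb : bounded_seq (fun k => x (s (t k)))) by (exists C; intros; apply HC).
  assert (E : p = vzero).
  { apply (delta_limit_unique HUC (fun k => x (s (t k)))); auto.
    - now apply opial_weak_delta.
    - apply (delta_cv_sub1 x vzero (fun k => s (t k))); auto. now apply strictly_incr_comp. }
  subst p. destruct (ev_ex _ (proj1 (Un_cv_ev _ _) (Hp f Hf) eps He)) as [k Hk]. now apply (Hs' (t k)).
Qed.

End WeakCompactness.

(** * The profile decomposition *)

Lemma vsum_bounded {X : NormedSpace} (t : nat -> nat -> X) M :
  (forall n, bounded_seq (t n)) -> bounded_seq (fun k => vsum (fun n => t n k) M).
Proof.
  intros H. induction M as [|M [B HB]].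
  - exists 0. intros k. simpl. rewrite vnorm_zero. lra.
  - destruct (H M) as [B' HB']. exists (B + B'). intros k. simpl.
    eapply Rle_trans; [apply vnorm_triangle|]. specialize (HB k). specialize (HB' k). cbv beta in HB. lra.
Qed.

Lemma list_upper_bound (F : list nat) N : exists M, (N <= M)%nat /\ forall n, In n F -> (n < M)%nat.
Proof.
  exists (max N (S (list_max F))). split; [lia|]. intros n Hn.
  assert (K := proj1 (list_max_le F (list_max F)) (Nat.le_refl _)).
  rewrite Forall_forall in K. specialize (K n Hn). lia.
Qed.

Theorem theorem7
  (X Y : NormedSpace) (J : X -> Y)
  (D0 D : (X -> X) -> Prop) (actY : (X -> X) -> Y -> Y)
  (HXB : Banach X) (HYB : Banach Y)
  (HXuc : uniformly_convex X) (HXus : uniformly_smooth X)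
  (HJ : continuous_embedding J)
  (HD0 : dislocation_group D0)
  (HDsub : forall g, D g -> D0 g)
  (HDid : D (fun x => x))
  (HactY : forall g, D g -> bij_lin_isometry (actY g) /\ (forall x, J (g x) = actY g (J x)))
  (u : nat -> X) (Hu : bounded_seq u) :
  exists (phi : nat -> nat) (Nset : nat -> bool) (w : nat -> X)
         (G : nat -> nat -> X -> X) (r : nat -> X),
    strictly_incr phi /\
    Nset 0%nat = true /\
    (forall n k, Nset n = true -> D (G n k)) /\
    (forall k x, G 0%nat k x = x) /\
    (forall n m, Nset n = true -> Nset m = true -> n <> m ->
       forall h : nat -> X -> X, (forall k, is_inverse (G n k) (h k)) ->
       ptw_weak0 (fun k x => h k (G m k x))) /\
    D_delta_cv D r vzero /\
    (* u_{phi k} = sum_{n in Nset} G n k (w n) + r k, unconditionally and uniformly in k *)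
    (forall eps, eps > 0 -> exists F0 : list nat,
       forall F : list nat, NoDup F -> incl F0 F -> forall k,
         vnorm (vsub (lsum F (fun n => if Nset n then G n k (w n) else vzero))
                     (vsub (u (phi k)) (r k))) < eps) /\
    (* energy bound *)
    ((forall k, vnorm (u k) <= 1) ->
       (forall n, Nset n = true -> vnorm (w n) <= 2) /\
       forall F : list nat, NoDup F -> forall eps, eps > 0 -> exists K, forall k, (k >= K)%nat ->
         vnorm (r k) + lsumR F (fun n => if Nset n then modconv X (vnorm (w n)) else 0)
           <= 1 + eps) /\
    (* remainder vanishes in Y *)
    ((DX_cocompact J D \/ (Opial X /\ cocompact_rel J D)) ->
       norm_cv (fun k => J (r k)) vzero).
Proof.
  destruct (profiles_exist HXB HXuc D0 D HD0 HDsub HDid u Hu)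
    as (phi & r & w & g & a & Hphi & Hr0 & HrS & HgD & Hg0 & Hbd & Hw & Ha & Hmax).
  assert (Hg : forall n k, D0 (g n k)) by auto.
  assert (Small := profile_sums_small HXuc D0 HD0 r w g a HrS Hg Hbd Hw Ha).
  destruct (delayed_series HXB (fun n k => g n k (w n)) Small) as (kappa & s & Series).
  (* The delay affects finitely many k for each n, so orthogonality survives, and [G 0] is still the
     identity because [g 0] is so at every index. *)
  set (G := fun n k => g n (max k (kappa n))).
  set (rho := fun k => vsub (u (phi k)) (s k)).
  assert (Hterm : forall n k, vnorm (g n k (w n)) = vnorm (w n)).
  { intros n k. now apply (D0_norm D0 HD0). }
  (* Once k exceeds the delays of the first M profiles, the delayed partial sum is the original one,
     and [rho] minus [r M] is that sum minus [s]. *)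
  assert (Close : forall eps, eps > 0 -> exists N, forall M, (N <= M)%nat ->
    ev (fun k => vnorm (vsub (rho k) (r M k)) <= eps)).
  { intros eps He. destruct (Series eps He) as [N HN]. exists N. intros M HM.
    apply (ev_imp _ _ (ev_forall_lt (fun n k => (kappa n <= k)%nat) M (fun n _ => ev_ge (kappa n)))).
    intros k Hk. specialize (HN (fun n => Nat.leb 0 n) M k HM (fun n _ => eq_refl)).
    rewrite (vsum_ext _ (fun n => vsel (Nat.leb 0 n) (g n k (w n)))) in HN
      by (intros n Hn; cbv beta; now rewrite Nat.max_l by auto).
    assert (T := remainder_telescope r w g HrS 0 M k ltac:(lia)). rewrite Hr0 in T.
    unfold rho. rewrite T.
    match type of HN with vnorm (vsub ?b _) <= _ =>
      replace (vsub (vsub (vadd (r M k) b) (s k)) (r M k)) with (vsub b (s k)) by vlin end.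
    exact HN. }
  assert (Vanish : forall eps, eps > 0 -> exists N, forall n, (N <= n)%nat -> vnorm (w n) < eps).
  { intros eps He. destruct (Small eps He) as [N HN]. exists N. intros n Hn.
    destruct (ev_ex _ (HN (Nat.eqb n) (S n) ltac:(intros m Hm; apply Nat.eqb_eq in Hm; lia))) as [k Hk].
    simpl in Hk. rewrite Nat.eqb_refl, vsum_zero, vadd_0 in Hk; [simpl in Hk; now rewrite Hterm in Hk|].
    intros m Hm. destruct (Nat.eqb_spec n m); [lia|reflexivity]. }
  assert (Hrho : bounded_seq rho).
  { destruct Hu as [C HC]. destruct (Series 1 ltac:(lra)) as [N HN].
    destruct (vsum_bounded (fun n k => g n (max k (kappa n)) (w n)) N) as [B HBd].
    { intros n. exists (vnorm (w n)). intros k. rewrite Hterm. lra. }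
    exists (C + (1 + B)). intros k. specialize (HC (phi k)). specialize (HBd k). cbv beta in HBd.
    specialize (HN (fun _ => true) N k (Nat.le_refl _) (fun _ _ => eq_refl)). cbn [vsel] in HN.
    set (b := vsum (fun n => g n (Nat.max k (kappa n)) (w n)) N) in *.
    pose proof (vnorm_diff (rho k) (u (phi k)) (s k) eq_refl).
    pose proof (vnorm_diff (s k) b (vsub b (s k)) ltac:(vlin)). lra. }
  assert (Null : D_delta_cv D rho vzero).
  { apply (remainder_null HXB HXuc D0 D HD0 HDsub r w); auto. }
  exists phi, (active w), w, G, rho. repeat split; auto.
  - intros n k _. apply HgD.
  - intros k x. apply Hg0.
  - intros n m An Am Hnm h Hh x.
    apply (weak_cv_ev_eq (fun k => inv (g n k) (g m k x))).
    + apply (ev_imp2 _ _ _ (ev_ge (kappa n)) (ev_ge (kappa m))). intros k Hn Hm.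
      rewrite (inverse_eq_inv D0 HD0 (G n k) (h k) (Hg _ _) (Hh k)). unfold G.
      now rewrite !Nat.max_l.
    + apply (proj2 (profiles_orthogonal HXuc D0 HD0 r w g HrS Hg Hbd Hw (S (max n m)))); auto; lia.
  - intros eps He. destruct (Series (eps / 2) ltac:(lra)) as [N HN].
    exists (seq 0 N). intros F HF Hincl k.
    destruct (list_upper_bound F N) as (M & HM & HFM).
    rewrite (lsum_vsum F _ M HF HFM).
    erewrite vsum_ext.
    + replace (vsub (u (phi k)) (rho k)) with (s k) by (unfold rho; vlin).
      eapply Rle_lt_trans; [apply (HN (fun n => if in_dec Nat.eq_dec n F then true else false) M k HM)|lra].
      intros n Hn. destruct (in_dec Nat.eq_dec n F) as [|K]; auto.
      destruct K. apply Hincl, in_seq. lia.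
    + intros n Hn. cbv beta. f_equal. unfold G. destruct (active w n) eqn:An; auto.
      symmetry. now apply (inactive_term D0 HD0 w g Hg).
  - intros n _. apply (profile_norm_le_2 HXuc D0 HD0 r w g HrS Hg Hbd Hw).
    intros k. rewrite Hr0. auto.
  - intros F HF eps He.
    assert (Hunit : forall k, vnorm (r O k) <= 1) by (intros k; rewrite Hr0; auto).
    destruct (Close (eps / 2) ltac:(lra)) as [N HN].
    (* The finite set is enlarged to an initial segment, where the stepwise energy estimate applies;
       the added moduli are nonnegative. *)
    destruct (list_upper_bound F N) as (M & HM & HFM).
    assert (En := profile_energy HXuc D0 HD0 r w g a HrS Hg Hbd Hw Ha Hunit M).
    assert (Le : lsumR F (fun n => if active w n then modconv X (vnorm (w n)) else 0) <=
                 lsumR (seq 0 M) (fun n => if active w n then modconv X (vnorm (w n)) else 0)).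
    { apply lsumR_incl; auto.
      - intros n Hn. apply in_seq. specialize (HFM n Hn). lia.
      - intros n. destruct (active w n); [|lra]. apply modconv_nonneg.
        now apply (profile_norm_le_2 HXuc D0 HD0 r w g HrS Hg Hbd Hw). }
    destruct (ev_and _ _ (HN M HM) (proj1 (Un_cv_ev _ _) (Ha M) (eps / 2) ltac:(lra))) as [K HK].
    exists K. intros k Hk. destruct (HK k Hk) as [K1 K2]. apply Rabs_def2 in K2.
    pose proof (vnorm_sum (rho k) (r M k) (vsub (rho k) (r M k)) ltac:(vlin)). lra.
  - destruct HJ as (HJlin & _). intros [HDX|[HO HC]].
    + rewrite <- (linear_zero J HJlin). now apply HDX.
    + apply HC. intros gam h HD Hh.
      assert (E : (fun k => h k (vsub (rho k) vzero)) = (fun k => h k (rho k))).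
      { apply functional_extensionality. intros k. now rewrite vsub_0_r. }
      (* Cocompactness relative to [D] asks for weak nullity, so Delta-nullity is upgraded along
         each family of dislocations. *)
      apply (opial_delta_weak HXB HXuc HXus HO).
      * destruct Hrho as [B HBd]. exists B. intros k.
        rewrite (inverse_eq_inv D0 HD0 (gam k) (h k)), (D0_norm D0 HD0); auto.
        apply (D0_inv D0 HD0). auto.
      * rewrite <- E. now apply (Null gam h).
Qed.
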